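(* For every $m,d\ge1$, every $\epsilon\in(0,1]$, and every degree-$d$ pseudo-density $D:\{0,1\}^m\to\mathbb{R}$, there exists $\alpha>0$ such that whenever $n\ge 2m$ and a nonnegative matrix $N:\binom{[n]}{m}\times\{0,1\}^n\to\mathbb{R}$ satisfies $\|N\|_\infty\le1$ and $\frac{1}{\|N\|_1}\mathrm{rk}_{\mathsf{psd}}(N)^2\le\alpha\,(n/\log n)^{d/2}$, we have $L_D(N)\ge-\epsilon$. Moreover, this holds with $\alpha=\left(\frac{C\epsilon}{d\,m^2\|D\|_\infty}\right)^{d/2}\left(\frac{\epsilon}{\|D\|_\infty}\right)^3$, where $C>0$ is a universal constant.
   Context: The degree of $g:\{0,1\}^m\to\mathbb{R}$ is the degree of the unique multilinear polynomial agreeing with $g$. A degree-$d$ pseudo-density is a map $D:\{0,1\}^m\to\mathbb{R}$ with $\mathbb E_x D(x)=1$ and $\mathbb E_x D(x)g(x)^2\ge0$ for all $g:\{0,1\}^m\to\mathbb{R}$ with $\deg(g)\le d/2$ (expectations over uniform $x$); $\|D\|_\infty=\max_x|D(x)|$. $\binom{[n]}{m}$ is the set of $m$-element subsets of $[n]$. For $x\in\{0,1\}^n$ and $S=\{i_1<\dots<i_m\}$, $x_S=(x_{i_1},\dots,x_{i_m})$. For $N:\binom{[n]}{m}\times\{0,1\}^n\to\mathbb{R}$, $L_D(N)=\mathbb E_x\mathbb E_S D(x_S)N(S,x)$ with $S$ uniform in $\binom{[n]}{m}$ and $x$ uniform in $\{0,1\}^n$; $\|N\|_\infty=\max_{S,x}N(S,x)$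 and $\|N\|_1=\mathbb E_{S,x}N(S,x)$. $\mathrm{rk}_{\mathsf{psd}}(N)$ is the smallest $r$ such that $N(S,x)=\mathrm{Tr}(A_SB_x)$ with symmetric psd $r\times r$ matrices $A_S,B_x$. $\log$ is the natural logarithm. *)

(* Defs.v *)
From HB Require Import structures.
From mathcomp Require Import all_boot all_order all_algebra.
From mathcomp Require Import boolp classical_sets reals exp.
(* The notations of mpoly clash with those of classical_sets. *)
From mathcomp Require Import -(notations) mpoly.

Set Implicit Arguments.
Unset Strict Implicit.
Unset Printing Implicit Defensive.

Import Order.TTheory GRing.Theory Num.Theory.
Local Open Scope classical_set_scope.
Local Open Scope ring_scope.

Definition cube (n : nat) := {ffun 'I_n -> bool}.

Definition msubsets (n m : nat) := {S : {set 'I_n} | #|S| == m}.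

Definition mean (R : realType) (T : finType) (f : T -> R) : R :=
  (\sum_(t : T) f t) / #|T|%:R.

Definition max_norm (R : realType) (T : finType) (f : T -> R) : R :=
  \big[Num.max/0]_(t : T) `|f t|.

Section Degree.
Variables (R : realType) (m : nat).
Implicit Types (p : mpoly m R) (g : cube m -> R).

Definition multilinear p :=
  forall mon, mon \in msupp p -> forall i : 'I_m, (mon i <= 1)%N.

Definition agrees_on_cube p g :=
  forall x : cube m, meval (fun i => (x i)%:R) p = g x.

Definition multilinear_ext g : mpoly m R :=
  xget 0 [set p | multilinear p /\ agrees_on_cube p g].

(* [mpoly.msize] is the total degree plus one, and 0 for the zero polynomial,
   so the zero function gets degree 0. *)
Definition cube_deg g : nat := (mpoly.msize (multilinear_ext g)).-1.

End Degree.

Definition pseudo_density (R : realType) (m d : nat) (D : cube m -> R) : Prop :=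
  mean D = 1 /\
  forall g : cube m -> R, (cube_deg g)%:R <= d%:R / 2 :> R ->
    0 <= mean (fun x => D x * g x ^+ 2).

Section Restriction.
Variables (n m : nat).

(* [enum] lists a set of ordinals in increasing order, so this is the
   (k+1)-st smallest element of S. *)
Definition elt (S : msubsets n m) (k : 'I_m) : 'I_n :=
  enum_val (cast_ord (esym (eqP (valP S))) k).

Definition restrict (x : cube n) (S : msubsets n m) : cube m :=
  [ffun k => x (elt S k)].

End Restriction.

Definition LD (R : realType) (m n : nat) (D : cube m -> R)
    (N : msubsets n m -> cube n -> R) : R :=
  mean (fun x : cube n =>
    mean (fun S : msubsets n m => D (restrict x S) * N S x)).

(* Without absolute values: used for entrywise nonnegative matrices only. *)
Definition mx_max (R : realType) (I J : finType) (N : I -> J -> R) : R :=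
  \big[Num.max/0]_(e : I * J) N e.1 e.2.

Definition mx_mean (R : realType) (I J : finType) (N : I -> J -> R) : R :=
  mean (fun e : I * J => N e.1 e.2).

Definition psdmx (R : realType) (r : nat) (A : 'M[R]_r) : Prop :=
  A^T = A /\ forall v : 'rV[R]_r, 0 <= (v *m A *m v^T) 0 0.

Definition psd_factorizable (R : realType) (I J : finType) (N : I -> J -> R)
    (r : nat) : Prop :=
  exists (A : I -> 'M[R]_r) (B : J -> 'M[R]_r),
    [/\ forall i, psdmx (A i), forall j, psdmx (B j)
      & forall i j, N i j = \tr (A i *m B j)].

Definition psd_rank (R : realType) (I J : finType) (N : I -> J -> R) : nat :=
  xget 0%N [set r | psd_factorizable N r /\
    forall s, psd_factorizable N s -> (r <= s)%N].

Definition LD_bound_with (R : realType) (m d : nat) (eps : R) (D : cube m -> R)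
    (alpha : R) : Prop :=
  forall (n : nat) (N : msubsets n m -> cube n -> R),
    (2 * m <= n)%N ->
    (forall S x, 0 <= N S x) ->
    mx_max N <= 1 ->
    1 / mx_mean N * (psd_rank N)%:R ^+ 2
      <= alpha * (n%:R / ln n%:R) `^ (d%:R / 2) ->
    - eps <= LD D N.

Section DegreeFacts.
Variables (R : realType) (m : nat).
Implicit Types (p q : mpoly m R) (g : cube m -> R).

Lemma multilinear_uniq p q g :
  multilinear p -> agrees_on_cube p g ->
  multilinear q -> agrees_on_cube q g -> p = q.
Proof.
move=> mlp pg mlq qg; apply/eqP; rewrite -subr_eq0; apply/negP => /negP r0.
set r := p - q in r0.
have mlr : multilinear r.
  move=> mon; rewrite mcoeff_msupp mcoeffB => nz i.
  have [pm|] := boolP (mon \in msupp p); first exact: mlp.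
  rewrite -mcoeff_eq0 => /eqP p0; apply: mlq; rewrite mcoeff_msupp.
  by apply: contraNneq nz => ->; rewrite p0 subrr.
have r_cube (x : cube m) : meval (fun i => (x i)%:R) r = 0.
  by rewrite mevalB pg qg subrr.
have [mon0 mon0r] : exists mon, mon \in msupp r.
  move: r0; rewrite -msupp_eq0; case: (msupp r) => [//|a s] _.
  by exists a; rewrite mem_head.
have exk : exists k, has (fun mon => mdeg mon == k) (msupp r).
  by exists (mdeg mon0); apply/hasP; exists mon0.
case: (ex_minnP exk) => k /hasP[mon monr /eqP monk] kmin.
have zero_prod mon' : mon' \in msupp r -> mon' != mon ->
    \prod_(i < m) ([ffun i => mon i != 0%N] i)%:R ^+ mon' i = 0 :> R.
  move=> m'r neq.
  have [le|/forallPn[i]] := boolP [forall i, (mon' i <= mon i)%N].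
    case/negP: neq; apply/eqP/mnmP => i.
    have le' j : (mon' j <= mon j)%N by move/forallP: le.
    have : (mdeg mon <= mdeg mon')%N.
      by rewrite monk; apply: kmin; apply/hasP; exists mon'.
    rewrite !mdegE => ge.
    have [le2] := leqif_sum (fun j (_ : true) => leqif_eq (le' j)).
    by rewrite eqn_leq le2 ge /= => /esym/forallP/(_ i)/eqP.
  rewrite -ltnNge => lt; rewrite (bigD1 i) //= ffunE.
  have mi0 : mon i = 0%N.
    by apply/eqP; rewrite -leqn0 -ltnS; apply: leq_trans lt (mlr _ m'r i).
  by rewrite mi0 eqxx /= expr0n; case: (mon' i) lt; rewrite mi0 // => *; rewrite mul0r.
have one_prod : \prod_(i < m) ([ffun i => mon i != 0%N] i)%:R ^+ mon i = 1 :> R.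
  rewrite big1 // => i _.
  by rewrite ffunE; case: (mon i) => [|j]; rewrite ?expr0 // expr1n.
have := r_cube [ffun i => mon i != 0%N].
rewrite mevalE (bigD1_seq mon) ?msupp_uniq //= one_prod mulr1.
rewrite big_seq_cond big1 => [|mon' /andP[m'r neq]]; last first.
  by rewrite zero_prod ?mulr0.
by rewrite addr0; apply/eqP; rewrite -mcoeff_msupp.
Qed.

Let mset (S : {set 'I_m}) : multinom m := Multinom [tuple (i \in S : nat) | i < m].

Let msetE S i : mset S i = (i \in S).
Proof. by rewrite multinomE tnth_mktuple. Qed.

Lemma multilinear_exists g :
  exists p, multilinear p /\ agrees_on_cube p g.
Proof.
have [c cP] : exists c : {set 'I_m} -> R, forall T : {set 'I_m}, (#|T| < m.+1)%N ->
    \sum_(S : {set 'I_m} | S \subset T) c S = g [ffun i => i \in T].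
  elim: m.+1 => [|k [c cP]]; first by exists (fun=> 0).
  exists (fun S : {set 'I_m} => if #|S| == k then
     g [ffun i => i \in S] - \sum_(U : {set 'I_m} | (U \subset S) && (U != S)) c U else c S).
  move=> T; rewrite ltnS leq_eqVlt => /orP[/eqP Tk|Tk].
    rewrite (bigD1 T) //= Tk eqxx.
    rewrite [X in _ + X](eq_bigr c) ?subrK // => U /andP[UT neq].
    have lt : (#|U| < k)%N.
      by rewrite -Tk proper_card // finset.properEneq neq.
    by rewrite (ltn_eqF lt).
  rewrite -cP //; apply: eq_bigr => U UT.
  by rewrite ltn_eqF // (leq_ltn_trans (subset_leq_card UT)).
exists (\sum_(S : {set 'I_m}) c S *: mpolyX R (mset S)); split.
  move=> mon; rewrite mcoeff_msupp raddf_sum /= => nz i.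
  have [S _] : exists2 S, true & mcoeff mon (c S *: mpolyX R (mset S)) != 0.
    apply/exists2P; apply: contrapT => H; case/negP: nz; apply/eqP.
    rewrite big1 // => S _; apply/eqP; apply: contrapT => /negP nz.
    by apply: H; exists S.
  rewrite mcoeffZ mcoeffX.
  have [<- _|_] := eqVneq (mset S) mon; last by rewrite mulr0 eqxx.
  by rewrite msetE leq_b1.
move=> x; rewrite raddf_sum /=.
have -> : g x = g [ffun i => i \in [set i | x i]%SET].
  by congr g; apply/ffunP => i; rewrite ffunE inE.
rewrite -cP; last by rewrite ltnS -[leqRHS]card_ord max_card.
rewrite [RHS]big_mkcond; apply: eq_bigr => S _; rewrite mevalZ mevalX.
case: ifPn => [/fintype.subsetP sub|/fintype.subsetPn[i iS]].
  rewrite big1 ?mulr1 // => i _; rewrite msetE.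
  have [/sub|] := boolP (i \in S); last by rewrite expr0.
  by rewrite inE => ->.
by rewrite inE (bigD1 i) //= msetE iS => /negbTE ->; rewrite mul0r mulr0.
Qed.

Lemma multilinear_extP g :
  multilinear (multilinear_ext g) /\ agrees_on_cube (multilinear_ext g) g.
Proof.
have [p pP] := multilinear_exists g.
exact: (@xgetPex _ 0 [set p | multilinear p /\ agrees_on_cube p g]
  (ex_intro _ p pP)).
Qed.

End DegreeFacts.

Lemma elt_mono (n m : nat) (S : msubsets n m) :
  {mono elt S : i j / (i < j)%N}.
Proof.
have srt : sorted ltn (map val (enum (val S))).
  rewrite -[enum _](eq_filter (mem_enum _)).
  rewrite -(eq_filter (mem_map val_inj _)) -filter_map.
  by rewrite (sorted_filter ltn_trans) // unlock val_ord_enum iota_ltn_sorted.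
have inc : {homo elt S : i j / (i < j)%N}.
  move=> i j ij; pose x0 := elt S i.
  rewrite /elt !(enum_val_nth x0) -!(nth_map x0 0%N) -?cardE ?ltn_ord //.
  by apply: (sorted_ltn_nth ltn_trans) => //; rewrite inE size_map -cardE ltn_ord.
move=> i j; apply/idP/idP; last exact: inc.
by apply: contraTT; rewrite -!leqNgt leq_eqVlt => /orP[/eqP/val_inj->//|/inc/ltnW].
Qed.

Lemma elt_mem (n m : nat) (S : msubsets n m) k : elt S k \in val S.
Proof. exact: enum_valP. Qed.

Lemma psd_factorizable_exists (R : realType) (I J : finType) (N : I -> J -> R) :
  (forall i j, 0 <= N i j) -> exists r, psd_factorizable N r.
Proof.
move=> N0.
have diag_psd (r : nat) (d : 'rV[R]_r) : (forall k, 0 <= d 0 k) -> psdmx (diag_mx d).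
  move=> d0; split=> [|v]; first by rewrite tr_diag_mx.
  rewrite mul_mx_diag !mxE sumr_ge0 // => k _.
  by rewrite !mxE mulrAC mulr_ge0 // -expr2 sqr_ge0.
exists #|I|, (fun i => diag_mx (delta_mx 0 (enum_rank i))).
exists (fun j => diag_mx (\row_k N (enum_val k) j)).
split=> [i|j|i j].
- by apply: diag_psd => k; rewrite mxE ler0n.
- by apply: diag_psd => k; rewrite mxE.
rewrite mulmx_diag mxtrace_diag (bigD1 (enum_rank i)) //= !mxE !eqxx mul1r.
rewrite enum_rankK big1 ?addr0 // => k /negbTE kn.
by rewrite !mxE kn andbF mul0r.
Qed.

Lemma psd_rankP (R : realType) (I J : finType) (N : I -> J -> R) :
  (forall i j, 0 <= N i j) ->
  psd_factorizable N (psd_rank N) /\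
  forall s, psd_factorizable N s -> (psd_rank N <= s)%N.
Proof.
move=> /psd_factorizable_exists ex.
have exb : exists r, `[< psd_factorizable N r >] by case: ex => r /asboolP; exists r.
case: (ex_minnP exb) => r /asboolP rN rmin.
apply: (@xgetPex _ 0%N [set r | psd_factorizable N r /\
  forall s, psd_factorizable N s -> (r <= s)%N]).
by exists r; split=> // s /asboolP; exact: rmin.
Qed.

(* Main.v *)
(** Write N(S,x) = Tr(P_S Q_x). An approximate Auerbach basis for the bodies
    {v | v^T v <= P_S} lets one change coordinates so that E_S P_S <= 1,
    P_S <= 4 r^2 and Tr Q_x <= 3. Let Delta be the max norm of D,
    F(x) = E_S D(x_S) P_S and G = 1 - F / Delta, which is psd, so that
    L_D(N) = E_x Tr(F Q).

    The entries of G^k have Fourier degree at most k m, so for a random S the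
    part of G^k of degree more than d/2 in the variables of S has relative
    squared norm at most (k m^2 / n)^(d/2). Hence the pseudo-density property,
    applied to the remaining part, gives E Tr(F G^(2k)) >= - Delta delta
    E Tr(G^(2k)) for a small delta, that is
    E Tr(G^(2k+1)) <= (1 + delta) E Tr(G^(2k)). By convexity of the moments
    E Tr(G^(2k)) <= (1 + delta)^(2k) r.

    On the other hand the tangent to g^(2k) at t = 1 + sigma yields the operator
    inequality - F <= Delta sigma + Delta / (2k t^(2k-1)) G^(2k). Pairing it
    with Q gives - L_D(N) <= 3 (Delta sigma + Delta t / (2k) r
    ((1 + delta) / t)^(2k)), and k of order d log n / sigma makes this at most
    eps. *)

Require Import Defs.
From mathcomp Require Import all_boot all_order all_algebra perm.
From mathcomp Require Import boolp classical_sets reals exp.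
From mathcomp Require Import -(notations) mpoly.
From mathcomp Require Import ring lra.
Set Implicit Arguments.
Unset Strict Implicit.
Unset Printing Implicit Defensive.
Import Order.TTheory GRing.Theory Num.Theory.
Local Open Scope ring_scope.

(** * Positive semidefinite matrices *)

Section PsdMatrices.
Variable R : realType.

Definition qform n (A : 'M[R]_n) (v : 'rV[R]_n) : R := (v *m A *m v^T) 0 0.

Lemma qformD n (A B : 'M[R]_n) v : qform (A + B) v = qform A v + qform B v.
Proof. by rewrite /qform mulmxDr mulmxDl mxE. Qed.

Lemma qformB n (A B : 'M[R]_n) v : qform (A - B) v = qform A v - qform B v.
Proof. by rewrite /qform mulmxBr mulmxBl !mxE. Qed.

Lemma qformZ n a (A : 'M[R]_n) v : qform (a *: A) v = a * qform A v.
Proof. by rewrite /qform -scalemxAr -scalemxAl mxE. Qed.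

Lemma qform_gram m n (C : 'M[R]_(m, n)) v :
  qform (C *m C^T) v = \sum_j (v *m C) 0 j ^+ 2.
Proof.
rewrite /qform mulmxA -mulmxA -trmx_mul mxE; apply: eq_bigr => j _.
by rewrite [X in _ * X]mxE expr2.
Qed.

Lemma qform_scalar n (a : R) (v : 'rV[R]_n) :
  qform a%:M v = a * \sum_j v 0 j ^+ 2.
Proof.
rewrite -scalemx1 qformZ; congr (_ * _).
by rewrite -[1%:M]mulmx1 -{2}trmx1 qform_gram mulmx1.
Qed.

Lemma psdmxD n (A B : 'M[R]_n) : psdmx A -> psdmx B -> psdmx (A + B).
Proof.
move=> [As A0] [Bs B0]; split; first by rewrite linearD /= As Bs.
by move=> v; rewrite -/(qform _ _) qformD addr_ge0 //; [exact: A0|exact: B0].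
Qed.

Lemma psdmxZ n a (A : 'M[R]_n) : 0 <= a -> psdmx A -> psdmx (a *: A).
Proof.
move=> a0 [As A0]; split; first by rewrite linearZ /= As.
by move=> v; rewrite -/(qform _ _) qformZ mulr_ge0 //; exact: A0.
Qed.

Lemma psdmx0 n : psdmx (0 : 'M[R]_n).
Proof. by split=> [|v]; rewrite ?trmx0 // mulmx0 mul0mx mxE. Qed.

Lemma psdmx_sum n (I : finType) (A : I -> 'M[R]_n) :
  (forall i, psdmx (A i)) -> psdmx (\sum_i A i).
Proof.
by move=> A0; apply: (big_ind (@psdmx R n)) => //; [exact: psdmx0|exact: psdmxD].
Qed.

Lemma psdmx_congr m n (C : 'M[R]_(m, n)) (A : 'M[R]_n) :
  psdmx A -> psdmx (C *m A *m C^T).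
Proof.
move=> [As A0]; split; first by rewrite !trmx_mul trmxK As mulmxA.
by move=> v; have := A0 (v *m C); rewrite trmx_mul !mulmxA.
Qed.

Lemma psdmx_gram m n (C : 'M[R]_(m, n)) : psdmx (C *m C^T).
Proof.
split; first by rewrite trmx_mul trmxK.
by move=> v; rewrite -/(qform _ _) qform_gram sumr_ge0 // => j _; rewrite sqr_ge0.
Qed.

Lemma psdmx_scalar n (a : R) : 0 <= a -> psdmx (a%:M : 'M[R]_n).
Proof.
move=> a0; rewrite -scalemx1; apply: psdmxZ => //.
by rewrite -[1%:M]mulmx1 -{2}trmx1; apply: psdmx_gram.
Qed.

(** The form is nonnegative on every [s *: u + t *: v], so its restriction to this plane has a
    nonnegative discriminant. *)
Lemma psdmx_cauchy n (A : 'M[R]_n) (u v : 'rV[R]_n) : psdmx A ->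
  (u *m A *m v^T) 0 0 ^+ 2 <= qform A u * qform A v.
Proof.
move=> [As A0].
set b := (u *m A *m v^T) 0 0.
have bE : (v *m A *m u^T) 0 0 = b.
  have -> : v *m A *m u^T = (u *m A *m v^T)^T by rewrite !trmx_mul trmxK As mulmxA.
  by rewrite mxE.
have Q s t : qform A (s *: u + t *: v) =
    s ^+ 2 * qform A u + 2 * s * t * b + t ^+ 2 * qform A v.
  rewrite /qform linearD /= !linearZ /= !mulmxDl !mulmxDr.
  rewrite -!scalemxAl -!scalemxAr ![fun_of_matrix (_ + _) _ _]mxE.
  by rewrite ![fun_of_matrix (_ *: _) _ _]mxE bE -/b; ring.
have a0 : 0 <= qform A u := A0 u.
have c0 : 0 <= qform A v := A0 v.
have P s t : 0 <= s ^+ 2 * qform A u + 2 * s * t * b + t ^+ 2 * qform A v.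
  by rewrite -Q; exact: A0.
have [a_eq|a_neq] := eqVneq (qform A u) 0.
  rewrite a_eq mul0r.
  have [->|bn] := eqVneq b 0; first by rewrite expr0n.
  (* With [qform A u = 0] the expression is affine in [s]; this [s] would make it equal to -1 if [b]
     were nonzero. *)
  have := P (- (qform A v + 1) / (2 * b)) 1; rewrite a_eq.
  have -> : (- (qform A v + 1) / (2 * b)) ^+ 2 * 0
     + 2 * (- (qform A v + 1) / (2 * b)) * 1 * b
     + 1 ^+ 2 * qform A v = -1 by field.
  by rewrite oppr_ge0 ler10.
have ap : 0 < qform A u by rewrite lt_neqAle eq_sym a_neq.
(* The minimizing direction, scaled to avoid a division. *)
have := P (- b) (qform A u).
have -> : (- b) ^+ 2 * qform A u + 2 * - b * qform A u * b + qform A u ^+ 2 * qform A v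
  = qform A u * (qform A u * qform A v - b ^+ 2) by ring.
by rewrite pmulr_rge0 // subr_ge0.
Qed.

Lemma qform_delta n (A : 'M[R]_n) i : qform A (delta_mx 0 i) = A i i.
Proof. by rewrite /qform -rowE trmx_delta -colE !mxE. Qed.

Lemma bilin_delta n (A : 'M[R]_n) i j :
  ((delta_mx 0 i : 'rV_n) *m A *m (delta_mx 0 j : 'rV_n)^T) 0 0 = A i j.
Proof. by rewrite -rowE trmx_delta -colE !mxE. Qed.

Lemma psdmx_diag_ge0 n (A : 'M[R]_n) i : psdmx A -> 0 <= A i i.
Proof. by move=> [_ A0]; rewrite -qform_delta; exact: A0. Qed.

Lemma psdmx_trace_ge0 n (A : 'M[R]_n) : psdmx A -> 0 <= \tr A.
Proof. by move=> A0; apply: sumr_ge0 => i _; exact: psdmx_diag_ge0. Qed.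

(* [a^-1] is 0 when [a = 0], and then [b = 0]: the Schur complement step covers
   the singular case too. *)
Lemma psdmx_cholesky n (A : 'M[R]_n) :
  psdmx A -> exists L : 'M[R]_n, A = L *m L^T.
Proof.
elim: n A => [|n IHn] A Apsd.
  by exists 0; apply/matrixP => -[].
move: A Apsd; rewrite -[n.+1]/(1 + n)%N => A Apsd.
have [As A0] := Apsd.
set a := A 0 0; set b := ursubmx A; set C := drsubmx A.
have Cs : C^T = C by rewrite -[C in RHS]/(drsubmx A) -As trmx_drsub.
have bE : dlsubmx A = b^T by rewrite /b trmx_ursub As.
have AE : A = block_mx a%:M b b^T C.
  rewrite -{1}[A]submxK bE; congr block_mx.
  apply/matrixP => i j; rewrite !mxE !ord1 /= mulr1n /a; congr (A _ _); exact/val_inj.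
have a0 : 0 <= a by exact: psdmx_diag_ge0.
(* By Cauchy-Schwarz, a zero diagonal entry of a psd matrix kills its whole row. *)
have bj0 : a = 0 -> b = 0.
  move=> az; apply/rowP => j.
  have := psdmx_cauchy (delta_mx 0 0) (delta_mx 0 (rshift 1 j)) Apsd.
  rewrite bilin_delta !qform_delta -/a az mul0r => h.
  rewrite [RHS]mxE; apply/eqP; rewrite -sqrf_eq0 eq_le sqr_ge0 andbT.
  by move: h; rewrite !mxE; congr (A _ _ ^+ 2 <= 0); exact/val_inj.
have aVa : (a^-1 * a) *: b = b.
  have [/bj0 ->|an] := eqVneq a 0; first by rewrite scaler0.
  by rewrite mulVf // scale1r.
have [L LE] : exists L : 'M_n, C - a^-1 *: (b^T *m b) = L *m L^T.
  apply: IHn; split; first by rewrite linearB linearZ /= trmx_mul trmxK Cs.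
  move=> v; rewrite -/(qform _ _) qformB qformZ.
  have -> : b^T *m b = b^T *m (b^T)^T by rewrite trmxK.
  rewrite qform_gram big_ord1; set be := v *m b^T.
  have beE : (b *m v^T) 0 0 = be 0 0.
    have -> : b *m v^T = be^T by rewrite trmx_mul trmxK.
    by rewrite mxE.
  set x := be 0 0 in beE *.
  (* The first coordinate [- (x / a)] minimizes the form of [A] for given [v]; the minimum is the
     form of the Schur complement at [v]. *)
  have : 0 <= qform A (row_mx (- (x / a))%:M v) by exact: A0.
  rewrite /qform AE mul_row_block tr_row_mx mul_row_col -/be tr_scalar_mx.
  rewrite mul_mx_scalar !mul_scalar_mx mulmxDl -scalemxAl.
  rewrite ![fun_of_matrix (_ + _) _ _]mxE ![fun_of_matrix (_ *: _) _ _]mxE.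
  rewrite ![fun_of_matrix (_ + _) _ _]mxE ![fun_of_matrix (_ *: _) _ _]mxE.
  rewrite [fun_of_matrix a%:M _ _]mxE /= mulr1n beE -/x.
  have [a_eq|an] := eqVneq a 0.
    by rewrite /x /be (bj0 a_eq) trmx0 mulmx0 [fun_of_matrix 0 _ _]mxE; lra.
  set q := fun_of_matrix _ _ _ => h.
  suff -> : q - a^-1 * x ^+ 2 =
    - (x / a) * (- (x / a) * a + x) + (- (x / a) * x + q) by [].
  by field.
exists (block_mx (Num.sqrt a)%:M 0 (a^-1 *: (Num.sqrt a *: b^T)) L).
rewrite tr_block_mx mulmx_block !trmx0 !mulmx0 !mul0mx !addr0 tr_scalar_mx.
rewrite -LE AE !linearZ /= trmxK -!(scalemxAl, scalemxAr).
rewrite -scalar_mxM -expr2 sqr_sqrtr // !mul_scalar_mx mul_mx_scalar.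
rewrite !scalerA -!mulrA -expr2 sqr_sqrtr // aVa; congr block_mx.
  by rewrite mulrCA -expr2 sqr_sqrtr // -{1}aVa linearZ.
have -> : a^-1 * (Num.sqrt a * (Num.sqrt a / a)) = a^-1.
  rewrite mulrA -expr2 sqr_sqrtr //; have [->|an] := eqVneq a 0.
    by rewrite invr0 !mulr0.
  by rewrite divff ?mulr1.
by rewrite scalerN addrCA subrr addr0.
Qed.

(** With [B = L *m L^T] the trace is that of the psd matrix [L^T *m A *m L]. *)
Lemma psdmx_tr_mul_ge0 n (A B : 'M[R]_n) :
  psdmx A -> psdmx B -> 0 <= \tr (A *m B).
Proof.
move=> Apsd /psdmx_cholesky[L ->].
rewrite mulmxA mxtrace_mulC; apply: psdmx_trace_ge0.
by have := psdmx_congr L^T Apsd; rewrite trmxK mulmxA.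
Qed.

Lemma psdmx_tr_le n (A B C : 'M[R]_n) :
  psdmx (B - A) -> psdmx C -> \tr (A *m C) <= \tr (B *m C).
Proof.
by move=> AB C0; rewrite -subr_ge0 -linearB -mulmxBl; exact: psdmx_tr_mul_ge0.
Qed.

Lemma row_cauchy n (u v : 'rV[R]_n) :
  (\sum_i u 0 i * v 0 i) ^+ 2 <= (\sum_i u 0 i ^+ 2) * (\sum_i v 0 i ^+ 2).
Proof.
have := psdmx_cauchy u v (psdmx_scalar n ler01).
rewrite !qform_scalar !mul1r mulmx1 mxE.
by under eq_bigr do rewrite [X in _ * X]mxE.
Qed.

(** With [A = L *m L^T], the form at [v] is the sum of the squared inner products of [v] with the
    columns of [L], and the squared norms of these columns add up to [\tr A]. *)
Lemma psdmx_le_trace n (A : 'M[R]_n) : psdmx A -> psdmx ((\tr A)%:M - A).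
Proof.
move=> Apsd; split; first by rewrite linearB /= tr_scalar_mx; case: Apsd => ->.
have [L LE] := psdmx_cholesky Apsd.
move=> v; rewrite -/(qform _ _) qformB qform_scalar {2}LE qform_gram subr_ge0.
have -> : \tr A = \sum_j \sum_i L i j ^+ 2.
  rewrite LE exchange_big; apply: eq_bigr => i _; rewrite mxE.
  by apply: eq_bigr => j _; rewrite mxE expr2.
rewrite mulr_suml; apply: ler_sum => j _; rewrite mulrC mxE.
have colE i : L i j = (col j L)^T 0 i by rewrite !mxE.
under eq_bigr do rewrite colE.
under [X in _ <= _ * X]eq_bigr do rewrite colE.
exact: row_cauchy.
Qed.

(** Cramer's rule: expansion along row [k] involves only the cofactors of [V] in that row. *)
Lemma det_row_replace n (V : 'M[R]_n) (v : 'rV[R]_n) k : V \in unitmx ->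
  \det (\matrix_(i, j) if i == k then v 0 j else V i j)
    = (v *m invmx V) 0 k * \det V.
Proof.
move=> Vu; set V' := \matrix_(i, j) _.
rewrite (expand_det_row V' k) mulrC -[RHS]mulr1.
rewrite unitmxE unitfE in Vu.
have -> : \det V * (v *m invmx V) 0 k = (v *m \adj V) 0 k.
  rewrite /invmx unitmxE unitfE Vu -scalemxAr mxE mulrA mulfV // mul1r.
  by [].
rewrite mulr1 mxE; apply: eq_bigr => j _; rewrite !mxE eqxx; congr (_ * _).
rewrite /cofactor; congr (_ * \det _); apply/matrixP => a b; rewrite !mxE.
by rewrite eq_sym (negPf (neq_lift _ _)).
Qed.

Lemma qform_rank1 n (w z : 'rV[R]_n) :
  qform (w^T *m w) z = (z *m w^T) 0 0 ^+ 2.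
Proof. by rewrite -[X in _ *m X]trmxK qform_gram big_ord1. Qed.

Lemma psdmx_sub_rank1 n (A : 'M[R]_n) (w : 'rV[R]_n) : A^T = A ->
  (forall z, (z *m w^T) 0 0 ^+ 2 <= qform A z) -> psdmx (A - w^T *m w).
Proof.
move=> As h; split; first by rewrite linearB /= trmx_mul trmxK As.
by move=> z; rewrite -/(qform _ _) qformB qform_rank1 subr_ge0.
Qed.

Lemma dotmxE n (u v : 'rV[R]_n) : (u *m v^T) 0 0 = \sum_i u 0 i * v 0 i.
Proof. by rewrite mxE; apply: eq_bigr => i _; rewrite [X in _ * X]mxE. Qed.

(** A crude Leibniz bound, which serves to make the supremum of determinants finite. *)
Lemma norm_det_le n (V : 'M[R]_n) (b : R) :
  (forall i j, `|V i j| <= b) -> `|\det V| <= #|'S_n|%:R * b ^+ n.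
Proof.
move=> Vb; apply: le_trans (ler_norm_sum _ _ _) _.
apply: le_trans (_ : \sum_(s : 'S_n) b ^+ n <= _); last first.
  by rewrite sumr_const mulr_natl.
apply: ler_sum => s _; rewrite normrM normrX normrN1 expr1n mul1r normr_prod.
rewrite -[X in _ ^+ X]card_ord -prodr_const; apply: ler_prod => i _.
by rewrite normr_ge0 Vb.
Qed.

(* A matrix whose rows are taken from the bodies {v | v^T v <= A_i} and whose
   determinant is within a factor 2 of the supremum: replacing a row by another
   vector of some body at most doubles the determinant, which bounds the
   coordinates of that vector by 2. *)
Lemma approx_auerbach (I : finType) (i0 : I) n (A : I -> 'M[R]_n) (tau : R) :
  0 < tau -> (forall i, psdmx (A i - tau%:M)) ->
  exists V : 'M[R]_n, [/\ V \in unitmx,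
    forall k, exists i, psdmx (A i - (row k V)^T *m row k V)
    & forall i, psdmx ((4 * n%:R) *: (V^T *m V) - A i)].
Proof.
move=> tau0 Atau.
have Apsd i : psdmx (A i).
  by rewrite -[A i](subrK tau%:M); apply: psdmxD => //; exact/psdmx_scalar/ltW.
have Asym i : (A i)^T = A i by case: (Apsd i).
pose K (v : 'rV[R]_n) := exists i, psdmx (A i - v^T *m v).
pose E : classical_sets.set R := fun x =>
  exists V : 'M[R]_n, (forall k, K (row k V)) /\ x = `|\det V|.
(* The rows of [V0] lie in the body of [i0] because [A i0] dominates [tau]; hence the supremum is
   positive. *)
pose V0 : 'M[R]_n := (Num.sqrt tau)%:M.
have KV0 k : K (row k V0).
  exists i0; apply: psdmx_sub_rank1 => // z.
  have := (Atau i0).2 z; rewrite -/(qform _ _) qformB qform_scalar subr_ge0.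
  apply: le_trans; rewrite dotmxE (bigD1 k) //= big1 ?addr0; last first.
    by move=> i ik; rewrite !mxE eq_sym (negPf ik) mulr0.
  rewrite !mxE eqxx mulr1n exprMn (sqr_sqrtr (ltW tau0)) [X in X <= _]mulrC ler_pM2l //.
  by rewrite (bigD1 k) //= ler_wpDr // sumr_ge0 // => i _; rewrite sqr_ge0.
have EV0 : E `|\det V0| by exists V0.
pose b := \sum_i \tr (A i).
have trb i : \tr (A i) <= b.
  by rewrite /b (bigD1 i) //= ler_wpDr // sumr_ge0 // => j _; exact: psdmx_trace_ge0.
have b0 : 0 <= b by apply: le_trans (trb i0); exact: psdmx_trace_ge0.
(* Vectors of the bodies have bounded entries, since the square of an entry is at most a diagonal
   entry of some [A i]. *)
have Kb v j : K v -> `|v 0 j| <= 1 + b.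
  move=> [i /psdmx_diag_ge0-/(_ j)]; rewrite !mxE big_ord1 !mxE subr_ge0 -expr2 => h.
  have {}h : v 0 j ^+ 2 <= b.
    apply: le_trans h (le_trans _ (trb i)).
    rewrite /mxtrace (bigD1 j) //= ler_wpDr // sumr_ge0 // => l _.
    exact: psdmx_diag_ge0.
  rewrite -(@ler_pXn2r _ 2) ?nnegrE ?addr_ge0 // real_normK ?num_real //.
  apply: le_trans h _; nra.
have supE : has_sup E.
  split; first by exists `|\det V0|.
  exists (#|'S_n|%:R * (1 + b) ^+ n) => _ [V [KV ->]].
  by apply: norm_det_le => i j; have := Kb _ j (KV i); rewrite mxE.
have s0 : 0 < sup E.
  apply: lt_le_trans (_ : `|\det V0| <= _); last exact: (sup_upper_bound supE).
  by rewrite normr_gt0 det_scalar expf_neq0 // gt_eqF ?sqrtr_gt0.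
have s2 : 0 < sup E / 2 by lra.
have [_ [V [KV ->]] sV] := sup_adherent s2 supE.
have dV0 : 0 < `|\det V| by lra.
have Vu : V \in unitmx by rewrite unitmxE unitfE -normr_gt0.
exists V; split=> // i.
(* [M] is [A i] in the coordinates given by the rows of [V]; [M k k] is the largest squared [k]-th
   coordinate of a vector of the body of [A i]. *)
pose M := (invmx V)^T *m A i *m invmx V.
have Mpsd : psdmx M.
  by have := psdmx_congr (invmx V)^T (Apsd i); rewrite trmxK.
have Mk k : M k k <= 4.
  set a := M k k.
  have a0 : 0 <= a by exact: psdmx_diag_ge0.
  have [->//|an] := eqVneq a 0.
  have ap : 0 < a by rewrite lt_neqAle eq_sym an.
  pose u := row k (invmx V)^T.
  have aE : qform (A i) u = a.
    by rewrite /a -[M k k]qform_delta /qform /M /u rowE trmx_mul trmxK !mulmxA.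
  (* The vector of the body whose [k]-th coordinate is the extremal value [Num.sqrt a]; putting it
     in row [k] multiplies the determinant by [Num.sqrt a], which must then be less than 2. *)
  pose v := (Num.sqrt a)^-1 *: (u *m A i).
  have Kv : K v.
    exists i; apply: psdmx_sub_rank1 => // z.
    rewrite /v linearZ /= -scalemxAr mxE exprMn exprVn sqr_sqrtr // mulrC.
    rewrite ler_pdivrMr // trmx_mul Asym mulmxA -aE.
    exact: psdmx_cauchy.
  pose V' := \matrix_(i, j) if i == k then v 0 j else V i j.
  have : `|\det V'| <= sup E.
    apply: (sup_upper_bound supE); exists V'; split=> // l.
    have [->|lk] := eqVneq l k.
      suff -> : row k V' = v by [].
      by apply/rowP => j; rewrite !mxE eqxx.
    suff -> : row l V' = row l V by exact: KV.
    by apply/rowP => j; rewrite !mxE (negPf lk).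
  rewrite det_row_replace // normrM.
  have -> : (v *m invmx V) 0 k = Num.sqrt a.
    rewrite /v -scalemxAl mxE.
    have -> : (u *m A i *m invmx V) 0 k = a.
      by rewrite /a /M /u -!row_mul !mxE.
    by rewrite -{2}(sqr_sqrtr a0) expr2 mulrA mulVf ?mul1r // gt_eqF ?sqrtr_gt0.
  rewrite ger0_norm ?sqrtr_ge0 // => h.
  have h2 : Num.sqrt a * `|\det V| < 2 * `|\det V| by lra.
  move: h2; rewrite ltr_pM2r // => h2.
  rewrite -(sqr_sqrtr a0) (_ : 4 = 2 ^+ 2); last by ring.
  by rewrite ler_pXn2r ?nnegrE ?sqrtr_ge0 // ltW.
(* The diagonal bound gives [M <= \tr M <= 4 n]; conjugation by [V^T] then turns [M] back into
   [A i]. *)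
have trM : \tr M <= 4 * n%:R.
  rewrite mulr_natr -[X in _ *+ X]card_ord -sumr_const; exact: ler_sum.
have : psdmx ((4 * n%:R)%:M - M).
  rewrite -[X in X - _](subrK (\tr M)%:M) -addrA.
  apply: psdmxD; last exact: psdmx_le_trace.
  by rewrite -raddfB; apply: psdmx_scalar; rewrite subr_ge0.
move=> /(psdmx_congr V^T); rewrite trmxK mulmxBr mulmxBl mul_mx_scalar -scalemxAl.
rewrite /M !mulmxA -trmx_mul mulVmx // trmx1 mul1mx -mulmxA mulVmx // mulmx1.
by [].
Qed.

(* Change of coordinates by a Cholesky factor of W = E_i A_i + V^T V / n, with V
   the approximate Auerbach basis of the A_i + tau; tau only makes the bodies
   full-dimensional. *)
Lemma psd_normalize (I J : finType) (i0 : I) n (A : I -> 'M[R]_n)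
    (B : J -> 'M[R]_n) :
  (0 < n)%N -> (forall i, psdmx (A i)) -> (forall j, psdmx (B j)) ->
  (forall i j, \tr (A i *m B j) <= 1) ->
  exists (A' : I -> 'M[R]_n) (B' : J -> 'M[R]_n),
    [/\ (forall i, psdmx (A' i)) /\ (forall j, psdmx (B' j)),
        forall i j, \tr (A' i *m B' j) = \tr (A i *m B j),
        psdmx (1%:M - #|I|%:R^-1 *: \sum_i A' i),
        forall i, psdmx ((4 * n%:R ^+ 2)%:M - A' i)
      & forall j, \tr (B' j) <= 3].
Proof.
move=> n_gt0 Apsd Bpsd AB1.
have n0 : 0 < n%:R :> R by rewrite ltr0n.
have trB0 j : 0 <= \tr (B j) by exact: psdmx_trace_ge0.
have sB0 : 0 <= \sum_j \tr (B j) by exact: sumr_ge0.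
(* Small enough that adding [tau] to [A i] raises each [\tr (A i *m B j)] by at most 1, hence to at
   most 2. *)
pose tau := (1 + \sum_j \tr (B j))^-1.
have tau0 : 0 < tau by rewrite invr_gt0; lra.
have tauB j : tau * \tr (B j) <= 1.
  rewrite mulrC ler_pdivrMr; last by lra.
  rewrite mul1r (bigD1 j) //=.
  have : 0 <= \sum_(i | i != j) \tr (B i) by exact: sumr_ge0.
  lra.
have Atau i : psdmx (A i + tau%:M - tau%:M) by rewrite addrK.
have [V [Vu KV AV]] := approx_auerbach i0 tau0 Atau.
pose Am := #|I|%:R^-1 *: \sum_i A i.
have Am0 : psdmx Am by apply: psdmxZ; [rewrite invr_ge0|exact: psdmx_sum].
have VV0 : psdmx (V^T *m V) by rewrite -[X in _ *m X]trmxK; exact: psdmx_gram.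
pose W := Am + n%:R^-1 *: (V^T *m V).
have nVV0 : psdmx (n%:R^-1 *: (V^T *m V)) by apply: psdmxZ => //; rewrite invr_ge0 ltW.
have W0 : psdmx W by exact: psdmxD.
have [L LE] := psdmx_cholesky W0.
(* A vector killed by [L] has zero form under [W], hence under [V^T *m V], and [V] is invertible. *)
have Lu : L \in unitmx.
  rewrite unitmxE unitfE; apply/det0P => -[v v0 vL].
  have : qform W v = 0.
    by rewrite LE qform_gram vL big1 // => j _; rewrite mxE expr0n.
  have VVE : V^T *m V = V^T *m (V^T)^T by rewrite trmxK.
  rewrite qformD [X in _ + X]qformZ VVE qform_gram => h.
  have h1 : 0 <= qform Am v by case: Am0 => _; apply.
  have h2 : 0 <= n%:R^-1 * \sum_j (v *m V^T) 0 j ^+ 2.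
    apply: mulr_ge0; first by rewrite invr_ge0 ler0n.
    by apply: sumr_ge0 => j _; exact: sqr_ge0.
  have /eqP : n%:R^-1 * \sum_j (v *m V^T) 0 j ^+ 2 = 0 by lra.
  rewrite mulf_eq0 invr_eq0 gt_eqF //= psumr_eq0 => [/allP z|j _]; last exact: sqr_ge0.
  case/negP: v0; apply/eqP; rewrite -[v](mulmxK (_ : V^T \in unitmx)) ?unitmx_tr //.
  have -> : v *m V^T = 0; last by rewrite mul0mx.
  apply/rowP => j; rewrite [RHS]mxE; apply/eqP; rewrite -sqrf_eq0.
  by apply: z; rewrite mem_index_enum.
have LTu : L^T \in unitmx by rewrite unitmx_tr.
have LWL : invmx L *m W *m (invmx L)^T = 1%:M.
  by rewrite LE mulmxA mulVmx // mul1mx -trmx_mul mulVmx // trmx1.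
exists (fun i => invmx L *m A i *m (invmx L)^T), (fun j => L^T *m B j *m L).
split.
- split=> [i|j]; first exact: psdmx_congr.
  by have := psdmx_congr L^T (Bpsd j); rewrite trmxK.
- move=> i j; rewrite -!mulmxA [(invmx L)^T *m _]mulmxA -trmx_mul mulmxV //.
  by rewrite trmx1 mul1mx mxtrace_mulC -!mulmxA mulmxV // mulmx1.
- rewrite -LWL -mulmx_suml -mulmx_sumr scalemxAl scalemxAr -mulmxBl -mulmxBr.
  by apply: psdmx_congr; rewrite /W -/Am addrAC subrr add0r.
(* In the old coordinates: [A i + tau <= 4 n V^T V <= 4 n^2 W]. *)
- move=> i.
  have -> : (4 * n%:R ^+ 2)%:M = (4 * n%:R ^+ 2) *: (invmx L *m W *m (invmx L)^T).
    by rewrite LWL scalemx1.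
  rewrite scalemxAl scalemxAr -mulmxBl -mulmxBr; apply: psdmx_congr.
  have -> : (4 * n%:R ^+ 2) *: W - A i = (4 * n%:R ^+ 2) *: Am +
     ((4 * n%:R) *: (V^T *m V) - (A i + tau%:M)) + tau%:M.
    rewrite scalerDr scalerA -[4 * _ ^+ 2 * _]mulrA expr2 -mulrA divff ?gt_eqF // mulr1.
    by rewrite opprD !addrA subrK.
  apply: psdmxD; last exact/psdmx_scalar/ltW.
  by apply: psdmxD => //; apply: psdmxZ => //; rewrite mulr_ge0 // exprn_ge0.
(* The trace is [\tr (W *m B j)]. The mean of the [A i] contributes at most 1; each row of [V] lies
   in the body of some [A i + tau], so the Auerbach part contributes at most 2. *)
- move=> j; rewrite mxtrace_mulC mulmxA -LE /W mulmxDl linearD /=.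
  rewrite -!scalemxAl !linearZ /= mulmx_suml linear_sum /=.
  have I0 : 0 < #|I|%:R :> R by rewrite ltr0n; apply/card_gt0P; exists i0.
  have h1 : #|I|%:R^-1 * (\sum_i \tr (A i *m B j)) <= 1.
    rewrite mulrC ler_pdivrMr // mul1r.
    by rewrite -sum1_card natr_sum; apply: ler_sum.
  have h2 : n%:R^-1 * \tr (V^T *m V *m B j) <= 2.
    rewrite mulrC ler_pdivrMr // -mulmxA mxtrace_mulC.
    rewrite mulr_natr -[X in _ *+ X]card_ord -sumr_const; apply: ler_sum => k _.
    have -> : (V *m B j *m V^T) k k = \tr ((row k V)^T *m row k V *m B j).
      rewrite -[_ *m row k V *m _]mulmxA mxtrace_mulC /mxtrace big_ord1.
      rewrite -row_mul [LHS]mxE [RHS]mxE; apply: eq_bigr => l _.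
      by rewrite [row k (V *m B j) 0 l]mxE ![fun_of_matrix _^T _ _]mxE [row k V 0 l]mxE.
    have [i Ki] := KV k.
    apply: le_trans (psdmx_tr_le Ki (Bpsd j)) _.
    rewrite mulmxDl linearD /= mul_scalar_mx linearZ /=.
    by have := AB1 i j; have := tauB j; lra.
  lra.
Qed.

End PsdMatrices.

(** * Polynomial inequalities evaluated at a psd matrix *)

Section PsdPolynomials.
Variables (R : realType) (n : nat) (G : 'M[R]_n.+1).
Hypothesis Gpsd : psdmx G.

Lemma trmx_horner_mx (p : {poly R}) : (horner_mx G p)^T = horner_mx G p.
Proof.
have [Gs _] := Gpsd.
elim/poly_ind: p => [|p c IH]; first by rewrite rmorph0 trmx0.
rewrite rmorphD rmorphM /= horner_mx_X horner_mx_C linearD /= tr_scalar_mx.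
by rewrite trmx_mul IH Gs; congr (_ + _); exact: comm_mx_horner.
Qed.

(** Half of the power joins [q]: the value is [Y *m Z *m Y] with [Y] symmetric and [Z] either the
    identity or [G], by the parity of [i]. *)
Lemma psdmx_horner_sqr i (q : {poly R}) :
  psdmx (horner_mx G ('X^i * q ^+ 2)).
Proof.
have -> : 'X^i * q ^+ 2 = ('X^(i./2) * q) * 'X^(odd i) * ('X^(i./2) * q).
  by rewrite -[in LHS](odd_double_half i) exprD -addnn exprD; ring.
rewrite !rmorphM /=; set Y := horner_mx G _ * _.
have YT : Y^T = Y by rewrite /Y -rmorphM /= trmx_horner_mx.
rewrite -{2}YT; apply: psdmx_congr; case: (odd i).
  by rewrite expr1 horner_mx_X.
by rewrite expr0 rmorph1; exact: psdmx_scalar.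
Qed.

(* j g^(j+1) - (j+1) t g^j + t^(j+1) = (g - t)^2 sum_(i < j) (i+1) t^(j-1-i) g^i *)
Lemma psdmx_horner_upper j (t : R) : 0 <= t ->
  psdmx (horner_mx G
    (j%:R *: 'X^(j.+1) - (j.+1%:R * t) *: 'X^j + (t ^+ j.+1)%:P)).
Proof.
move=> t0; elim: j => [|j IH].
  rewrite scale0r add0r expr0 mul1r expr1 alg_polyC addNr rmorph0.
  exact: psdmx0.
have -> : j.+1%:R *: 'X^(j.+2) - (j.+2%:R * t) *: 'X^(j.+1) + (t ^+ j.+2)%:P =
   t *: (j%:R *: 'X^(j.+1) - (j.+1%:R * t) *: 'X^j + (t ^+ j.+1)%:P)
   + j.+1%:R *: ('X^j * ('X - t%:P) ^+ 2) :> {poly R}.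
  rewrite -!mul_polyC !(exprS t) !(exprS 'X) -!natr1.
  by rewrite !polyCM !polyCD !polyC_natr !polyC1; ring.
rewrite linearD /= linearZ [X in _ + X]linearZ /=; apply: psdmxD; apply: psdmxZ => //.
exact: psdmx_horner_sqr.
Qed.

(** The bracket is the gap between the power [j.+1] and its tangent at [t]. Passing from [j] to
    [j.+1] multiplies it by ['X] and adds a multiple of [('X - t%:P) ^+ 2]; the factor ['X^i]
    absorbs that ['X] in the induction. *)
Lemma psdmx_horner_tangent i j (t : R) : 0 <= t ->
  psdmx (horner_mx G
    ('X^i * ('X^(j.+1) - (j.+1%:R * t ^+ j) *: 'X + (j%:R * t ^+ j.+1)%:P))).
Proof.
move=> t0; elim: j i => [|j IH] i.
  by rewrite expr1 expr0 mulr1 scale1r subrr mul0r add0r mulr0 rmorph0; exact: psdmx0.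
have -> : 'X^i * ('X^(j.+2) - (j.+2%:R * t ^+ j.+1) *: 'X + (j.+1%:R * t ^+ j.+2)%:P) =
  'X^(i.+1) * ('X^(j.+1) - (j.+1%:R * t ^+ j) *: 'X + (j%:R * t ^+ j.+1)%:P)
  + (j.+1%:R * t ^+ j) *: ('X^i * ('X - t%:P) ^+ 2) :> {poly R}.
  rewrite -!mul_polyC !(exprS t) !(exprS 'X) -!natr1.
  by rewrite !polyCM !polyCD !polyC_natr !polyC1; ring.
rewrite linearD /= [X in _ + X]linearZ /=; apply: psdmxD => //.
by apply: psdmxZ; [rewrite mulr_ge0 // exprn_ge0|exact: psdmx_horner_sqr].
Qed.

Lemma psdmx_exp i : psdmx (G ^+ i).
Proof.
have := psdmx_horner_sqr i 1; rewrite expr1n mulr1 rmorphXn /=.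
by rewrite horner_mx_X.
Qed.

(** The weighted arithmetic-geometric inequality for [t] and the eigenvalues of [G], summed over the
    eigenvalues. *)
Lemma tr_exp_le j (t : R) : 0 <= t ->
  j.+1%:R * t * \tr (G ^+ j) <= j%:R * \tr (G ^+ j.+1) + t ^+ j.+1 * n.+1%:R.
Proof.
move=> t0; have := psdmx_trace_ge0 (psdmx_horner_upper j t0).
move: (t ^+ j.+1) => c.
rewrite !linearD linearN /= !linearZ /= !rmorphXn /= horner_mx_X horner_mx_C.
rewrite linearN mxtrace_scalar -mulr_natr /=; lra.
Qed.

Lemma psdmx_tangent j (t : R) : 0 <= t ->
  psdmx (G ^+ j.+1 - (j.+1%:R * t ^+ j) *: G + (j%:R * t ^+ j.+1)%:M).
Proof.
move=> t0; have := psdmx_horner_tangent 0 j t0.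
rewrite expr0 mul1r !linearD linearN /= !linearZ /= !rmorphXn /= horner_mx_X.
by rewrite horner_mx_C.
Qed.

End PsdPolynomials.

(** * Fourier analysis on the cube *)

Section Mean.
Variables (R : realType) (T : finType).
Implicit Types f g : T -> R.

Lemma eq_mean f g : f =1 g -> mean f = mean g.
Proof. by move=> fg; rewrite /mean; congr (_ / _); apply: eq_bigr => t _. Qed.

Lemma meanD f g : mean (fun t => f t + g t) = mean f + mean g.
Proof. by rewrite /mean big_split mulrDl. Qed.

Lemma meanN f : mean (fun t => - f t) = - mean f.
Proof. by rewrite /mean sumrN mulNr. Qed.

Lemma meanZ a f : mean (fun t => a * f t) = a * mean f.
Proof. by rewrite /mean -mulr_sumr mulrA. Qed.

Lemma mean_sum (I : finType) (P : pred I) (F : I -> T -> R) :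
  mean (fun t => \sum_(i | P i) F i t) = \sum_(i | P i) mean (F i).
Proof. by rewrite /mean exchange_big mulr_suml. Qed.

Lemma ler_mean f g : (forall t, f t <= g t) -> mean f <= mean g.
Proof.
by move=> fg; rewrite /mean ler_wpM2r ?invr_ge0 ?ler0n //; apply: ler_sum => t _.
Qed.

Lemma mean_ge0 f : (forall t, 0 <= f t) -> 0 <= mean f.
Proof. by move=> f0; rewrite /mean divr_ge0 ?ler0n // sumr_ge0. Qed.

Lemma mean_const (t0 : T) (a : R) : mean (fun _ : T => a) = a.
Proof.
rewrite /mean sumr_const -[a *+ _]mulr_natr mulfK // pnatr_eq0 -lt0n.
by apply/card_gt0P; exists t0.
Qed.

End Mean.

Lemma exchange_mean (R : realType) (T U : finType) (F : T -> U -> R) :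
  mean (fun t => mean (F t)) = mean (fun u => mean (fun t => F t u)).
Proof.
by rewrite /mean -!mulr_suml exchange_big mulrAC.
Qed.

Lemma le_max_norm (R : realType) (T : finType) (f : T -> R) t :
  `|f t| <= max_norm f.
Proof. by rewrite /max_norm (le_bigmax _ (fun t => `|f t|)). Qed.

Section Characters.
Variables (R : realType) (n : nat).
Implicit Types u v x : cube n.

(** The Fourier character indexed by the set with indicator [u]; sets are encoded as points of the
    cube, so symmetric difference is [xorc]. *)
Definition chi u x : R := \prod_i (-1) ^+ (u i && x i).

Definition weight u : nat := \sum_i u i.

Definition xorc u v : cube n := [ffun i => u i (+) v i].

Lemma xorcK u : involutive (xorc u).
Proof. by move=> v; apply/ffunP => i; rewrite !ffunE addKb. Qed.

Lemma chi_xor u v x : chi (xorc u v) x = chi u x * chi v x.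
Proof.
rewrite /chi -big_split; apply: eq_bigr => i _; rewrite ffunE.
by case: (u i); case: (v i); case: (x i);
  rewrite /= ?expr0 ?expr1 ?mulr1 ?mul1r // mulrNN mulr1.
Qed.

Lemma weight_xor u v : (weight (xorc u v) <= weight u + weight v)%N.
Proof.
rewrite /weight -big_split; apply: leq_sum => i _; rewrite ffunE.
by case: (u i); case: (v i).
Qed.

Definition cube0 : cube n := [ffun=> false].

Lemma chi0 x : chi cube0 x = 1.
Proof. by rewrite /chi big1 // => i _; rewrite ffunE. Qed.

Lemma mean_chi u : mean (chi u) = (u == cube0)%:R.
Proof.
have [->|u0] := eqVneq u cube0.
  by rewrite (eq_mean chi0) (mean_const cube0).
rewrite /mean /chi.
rewrite -(bigA_distr_bigA (fun i (b : bool) => (-1) ^+ (u i && b))).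
have [i ui] : exists i, u i.
  apply/existsP; apply: contraNT u0; rewrite negb_exists => /forallP h.
  by apply/eqP/ffunP => i; rewrite ffunE; apply/negbTE.
by rewrite (bigD1 i) //= big_bool /= ui /= expr0 expr1 addNr !mul0r.
Qed.

Lemma xorc_eq0 u v : (xorc u v == cube0) = (u == v).
Proof.
apply/eqP/eqP => [/ffunP h|->]; last by apply/ffunP => i; rewrite !ffunE addbb.
by apply/ffunP => i; have := h i; rewrite !ffunE; case: (u i); case: (v i).
Qed.

Lemma parseval (P : pred (cube n)) (c : cube n -> R) :
  mean (fun x => (\sum_(u | P u) c u * chi u x) ^+ 2) = \sum_(u | P u) c u ^+ 2.
Proof.
under eq_mean => x do rewrite expr2 mulr_suml.
rewrite mean_sum; apply: eq_bigr => u Pu.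
under eq_mean => x do rewrite mulr_sumr.
rewrite mean_sum (bigD1 u) //= big1 ?addr0 => [|v /andP[Pv vu]].
  under eq_mean => x do rewrite mulrACA -chi_xor.
  by rewrite meanZ mean_chi xorc_eq0 eqxx mulr1 expr2.
under eq_mean => x do rewrite mulrACA -chi_xor.
by rewrite meanZ mean_chi xorc_eq0 eq_sym (negPf vu) mulr0.
Qed.

End Characters.

(** * Fourier degree of functions with values in an algebra *)

Section FourierDegree.
Variables (R : realType) (n : nat) (A : algType R).
Implicit Types f g : cube n -> A.

(** Coefficients in an algebra allow the matrix-valued powers of [gap_mx]. *)
Definition fourier_deg_le j f := exists c : cube n -> A,
  (forall u, (j < weight u)%N -> c u = 0) /\
  (forall x, f x = \sum_u chi R u x *: c u).

Lemma fourier_deg_leW j l f : (j <= l)%N -> fourier_deg_le j f -> fourier_deg_le l f.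
Proof.
by move=> jl [c [c0 cE]]; exists c; split=> // u /(leq_ltn_trans jl)/c0.
Qed.

Lemma eq_fourier_deg j f g : f =1 g -> fourier_deg_le j f -> fourier_deg_le j g.
Proof. by move=> fg [c [c0 cE]]; exists c; split=> // x; rewrite -fg. Qed.

Lemma fourier_deg_const (a : A) : fourier_deg_le 0 (fun=> a).
Proof.
exists (fun u => if u == cube0 n then a else 0); split=> [u u0|x].
  by case: eqP u0 => // ->; rewrite /weight big1 // => i _; rewrite ffunE.
rewrite (bigD1 (cube0 n)) //= eqxx chi0 scale1r big1 ?addr0 // => u /negPf ->.
by rewrite scaler0.
Qed.

Lemma fourier_degD j f g : fourier_deg_le j f -> fourier_deg_le j g ->
  fourier_deg_le j (fun x => f x + g x).
Proof.
move=> [c [c0 cE]] [d [d0 dE]]; exists (fun u => c u + d u); split=> [u ju|x].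
  by rewrite c0 // d0 // addr0.
by rewrite cE dE -big_split; apply: eq_bigr => u _; rewrite scalerDr.
Qed.

(** The coefficients of a product are a convolution over [xorc], and weights are subadditive. *)
Lemma fourier_degM j l f g : fourier_deg_le j f -> fourier_deg_le l g ->
  fourier_deg_le (j + l) (fun x => f x * g x).
Proof.
move=> [c [c0 cE]] [d [d0 dE]].
exists (fun w => \sum_u c u * d (xorc u w)); split=> [w jl|x].
  rewrite big1 // => u _; have [ju|uj] := ltnP j (weight u).
    by rewrite c0 // mul0r.
  rewrite d0 ?mulr0 //; have := weight_xor u (xorc u w); rewrite xorcK => h.
  rewrite -(ltn_add2l j); apply: leq_trans jl (leq_trans h _).
  by rewrite leq_add2r.
rewrite cE dE mulr_suml.
under [RHS]eq_bigr => w _ do rewrite scaler_sumr.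
rewrite exchange_big; apply: eq_bigr => u _; rewrite mulr_sumr.
rewrite (reindex_inj (inv_inj (xorcK u))) /=; apply: eq_bigr => w _.
rewrite -scalerAl -scalerAr scalerA -chi_xor; congr (chi _ _ _ *: _).
by rewrite -[RHS](xorcK u).
Qed.

Lemma fourier_deg_sum (I : finType) j (F : I -> cube n -> A) :
  (forall i, fourier_deg_le j (F i)) -> fourier_deg_le j (fun x => \sum_i F i x).
Proof.
move=> FE; elim: (index_enum I) => [|i s IH].
  apply: (@eq_fourier_deg _ (fun=> 0)) => [x|]; first by rewrite big_nil.
  exact: fourier_deg_leW (fourier_deg_const 0).
apply: (@eq_fourier_deg _ (fun x => F i x + \sum_(i <- s) F i x)) => [x|].
  by rewrite big_cons.
exact: fourier_degD.
Qed.

Lemma fourier_degX j k f :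
  fourier_deg_le j f -> fourier_deg_le (k * j) (fun x => f x ^+ k).
Proof.
move=> fj; elim: k => [|k IH].
  apply: (@eq_fourier_deg _ (fun=> 1)) => [x|]; first by rewrite expr0.
  exact: fourier_deg_const.
apply: (@eq_fourier_deg _ (fun x => f x * f x ^+ k)) => [x|]; first by rewrite exprS.
by rewrite mulSn; exact: fourier_degM.
Qed.

Lemma fourier_degZ j (a : R) f :
  fourier_deg_le j f -> fourier_deg_le j (fun x => a *: f x).
Proof.
move=> [c [c0 cE]]; exists (fun u => a *: c u); split=> [u /c0->|x].
  by rewrite scaler0.
rewrite cE scaler_sumr; apply: eq_bigr => u _.
by rewrite !scalerA mulrC.
Qed.

(** The indicator is one half plus [(-1) ^+ b / 2] times the character of the singleton of [i]. *)
Lemma fourier_deg_coord i b :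
  fourier_deg_le 1 (fun x => (x i == b)%:R%:A).
Proof.
pose ui : cube n := [ffun k => k == i].
have ui1 : weight ui = 1%N.
  rewrite /weight (bigD1 i) //= ffunE eqxx big1 // => k ki.
  by rewrite ffunE (negPf ki).
have chi_ui x : chi R ui x = (-1) ^+ x i.
  rewrite /chi (bigD1 i) //= ffunE eqxx big1 ?mulr1 // => k ki.
  by rewrite ffunE (negPf ki).
have d1 : fourier_deg_le 1 (fun x => chi R ui x *: (1 : A)).
  exists (fun u => if u == ui then 1 else 0); split=> [u|x].
    by case: eqP => // ->; rewrite ui1.
  rewrite (bigD1 ui) //= eqxx big1 ?addr0 // => u /negPf ->.
  by rewrite scaler0.
have d0 := fourier_deg_leW (leq0n 1) (fourier_deg_const ((2^-1)%:A)).
apply: (eq_fourier_deg _ (fourier_degD d0 (fourier_degZ ((-1) ^+ b / 2) d1))) => x.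
rewrite chi_ui scalerA -scalerDl; congr (_ *: _).
by case: (x i); case: b; rewrite /= ?expr0 ?expr1; field.
Qed.

(** Expand [D] over the points [y] of the small cube: the indicator of [restrict x S = y] is a
    product of [m] coordinate indicators. *)
Lemma fourier_deg_restrict m (S : msubsets n m) (D : cube m -> R) (a : A) :
  fourier_deg_le m (fun x => D (restrict x S) *: a).
Proof.
pose ind (y : cube m) (x : cube n) : A := \prod_k (x (elt S k) == y k)%:R%:A.
have indE y x : ind y x = (restrict x S == y)%:R%:A.
  rewrite /ind -(rmorph_prod (in_alg A)) /=; congr (_ *: _).
  have [<-|ne] := eqVneq (restrict x S) y.
    by rewrite big1 // => k _; rewrite ffunE eqxx.
  have [k nk] : exists k, restrict x S k != y k.
    apply/existsP; apply: contraNT ne; rewrite negb_exists => /forallP h.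
    by apply/eqP/ffunP => k; have := h k; rewrite negbK => /eqP.
  by rewrite (bigD1 k) //=; move: nk; rewrite ffunE => /negPf ->; rewrite mul0r.
have ind_deg y : fourier_deg_le m (ind y).
  have : fourier_deg_le (size (index_enum 'I_m)) (ind y).
    rewrite /ind; elim: (index_enum 'I_m) => [|k s IH].
      apply: (@eq_fourier_deg _ (fun=> 1)) => [x|]; first by rewrite big_nil.
      exact: fourier_deg_const.
    apply: (@eq_fourier_deg _ (fun x => (x (elt S k) == y k)%:R%:A *
      \prod_(k <- s) (x (elt S k) == y k)%:R%:A)) => [x|]; first by rewrite big_cons.
    by rewrite /= -add1n; apply: fourier_degM; first exact: fourier_deg_coord.
  by rewrite -sum1_size sum1_card card_ord.
apply: (@eq_fourier_deg _ (fun x => \sum_y (D y *: ind y x) * a)) => [x|]; last first.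
  apply: fourier_deg_sum => y; rewrite -[m]addn0; apply: fourier_degM.
    exact: fourier_degZ.
  exact: fourier_deg_const.
rewrite (bigD1 (restrict x S)) //= indE eqxx scale1r big1 ?addr0 => [|y ne].
  by rewrite -scalerAl mul1r.
by rewrite indE eq_sym (negPf ne) scale0r scaler0 mul0r.
Qed.

End FourierDegree.

(** * From Fourier degree to polynomial degree *)

Section CubeDegree.
Variables (R : realType) (m : nat).
Implicit Types (w y : cube m) (g : cube m -> R).

Let mon w : multinom m := Multinom [tuple (w i : nat) | i < m].

Let monE w i : mon w i = w i.
Proof. by rewrite multinomE tnth_mktuple. Qed.

Let monom w y : R := \prod_i (y i)%:R ^+ w i.

Let monomial_deg_le e g := exists a : cube m -> R,
  (forall w, (e < weight w)%N -> a w = 0) /\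
  (forall y, g y = \sum_w a w * monom w y).

(** Uniqueness of the multilinear extension identifies it with the explicit polynomial. *)
Lemma monomial_cube_deg e g : monomial_deg_le e g -> (cube_deg g <= e)%N.
Proof.
move=> [a [a0 aE]].
pose p : mpoly m R := \sum_w a w *: mpolyX R (mon w).
have supp mn : mn \in msupp p -> exists2 w, a w != 0 & mn = mon w.
  rewrite mcoeff_msupp raddf_sum /= => nz.
  apply: contrapT => H; case/negP: nz; apply/eqP; rewrite big1 // => w _.
  rewrite mcoeffZ mcoeffX; have [E|_] := eqVneq (mon w) mn; last by rewrite mulr0.
  have [->|aw] := eqVneq (a w) 0; first by rewrite mul0r.
  by case: H; exists w.
have pml : multilinear p.
  by move=> mn /supp[w _ ->] i; rewrite monE leq_b1.
have pg : agrees_on_cube p g.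
  move=> y; rewrite aE raddf_sum; apply: eq_bigr => w _ /=.
  rewrite mevalZ mevalX; congr (_ * _); apply: eq_bigr => i _.
  by rewrite monE.
have [ml ag] := multilinear_extP g.
rewrite /cube_deg (multilinear_uniq ml ag pml pg).
suff : (mpoly.msize p <= e.+1)%N by case: (mpoly.msize p).
rewrite msizeE; apply/bigmax_leqP_seq => mn /supp[w aw ->] _.
rewrite ltnS mdegE; under eq_bigr do rewrite monE.
by rewrite leqNgt; apply: contra aw => /a0 ->.
Qed.

(** Expand the product of the factors [1 - 2 w_i y_i]; only monomials supported inside [w]
    survive. *)
Lemma monomial_deg_chi w : monomial_deg_le (weight w) (chi R w).
Proof.
exists (fun v => \prod_i (if v i then - 2 * (w i)%:R else 1)); split=> [v wv|y].
  have [i /andP[vi wi]] : exists i, v i && ~~ w i.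
    apply/existsP; apply: contraLR wv; rewrite negb_exists -leqNgt => /forallP h.
    apply: leq_sum => i _; have := h i.
    by case: (v i); case: (w i).
  by rewrite (bigD1 i) //= vi (negPf wi) mulr0 mul0r.
transitivity (\prod_i \sum_(b : bool)
    (if b then - 2 * (w i)%:R else 1) * (y i)%:R ^+ b : R).
  apply: eq_bigr => i _; rewrite big_bool /= expr1 expr0 mulr1.
  by case: (w i); case: (y i); rewrite /= ?expr0 ?expr1; ring.
rewrite bigA_distr_bigA; apply: eq_bigr => v _ /=.
by rewrite big_split.
Qed.

Lemma cube_deg_chi_sum e (T : finType) (P : pred T) (b : T -> R) (v : T -> cube m) :
  (forall t, P t -> (weight (v t) <= e)%N) ->
  (cube_deg (fun y => \sum_(t | P t) b t * chi R (v t) y)%R <= e)%N.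
Proof.
move=> ve; apply: monomial_cube_deg.
(* The premise [P t] stands under the existential so that [choice] applies to every [t]. *)
have H t : exists a : cube m -> R, P t ->
   (forall w, (e < weight w)%N -> a w = 0) /\
   (forall y, chi R (v t) y = \sum_w a w * monom w y).
  have [a [a0 aE]] := monomial_deg_chi (v t); exists a => Pt; split=> // w ew.
  by apply: a0; apply: leq_ltn_trans ew; exact: ve.
have [a aP] := choice H.
exists (fun w => \sum_(t | P t) b t * a t w); split=> [w ew|y].
  by rewrite big1 // => t Pt; have [a0 _] := aP t Pt; rewrite a0 // mulr0.
under [RHS]eq_bigr do rewrite mulr_suml.
rewrite exchange_big; apply: eq_bigr => t Pt; have [_ ->] := aP t Pt.
by rewrite mulr_sumr; apply: eq_bigr => w _; rewrite mulrA.
Qed.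

End CubeDegree.

(** * Resampling the coordinates of a subset *)

Section Patch.
Variables (R : realType) (n m : nat) (S : msubsets n m).
Implicit Types (x u : cube n) (y : cube m).

Lemma elt_inj : injective (elt S).
Proof.
move=> i j e; apply/val_inj; case: (ltngtP i j) => //.
  by rewrite -(elt_mono S i j) e ltnn.
by rewrite -(elt_mono S j i) e ltnn.
Qed.

Definition patch x y : cube n :=
  [ffun i => if [pick k | elt S k == i] is Some k then y k else x i].

Lemma patch_elt x y k : patch x y (elt S k) = y k.
Proof.
rewrite ffunE; case: pickP => [l /eqP/elt_inj -> //|/(_ k)].
by rewrite eqxx.
Qed.

Lemma patch_out x y i : (forall k, elt S k != i) -> patch x y i = x i.
Proof.
by move=> ni; rewrite ffunE; case: pickP => // k; rewrite (negPf (ni k)).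
Qed.

Lemma restrict_patch x y : restrict (patch x y) S = y.
Proof. by apply/ffunP => k; rewrite ffunE patch_elt. Qed.

Lemma patchK x y : patch (patch x y) (restrict x S) = x.
Proof.
apply/ffunP => i; rewrite !ffunE; by case: pickP => // k /eqP <-; rewrite ffunE.
Qed.

(* (x, y) |-> (patch x y, x_S) is an involution. *)
Lemma mean_patch (f : cube n -> R) :
  mean f = mean (fun x => mean (fun y => f (patch x y))).
Proof.
have y0 : cube m := [ffun=> false].
transitivity (mean (fun x => mean (fun _ : cube m => f x))).
  by apply: eq_mean => x; rewrite mean_const.
rewrite /mean -!mulr_suml; congr (_ / _ / _); rewrite !pair_big /=.
pose h (p : cube n * cube m) := (patch p.1 p.2, restrict p.1 S).
have hK : involutive h.
  by move=> [x y]; rewrite /h /= patchK restrict_patch.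
by rewrite (reindex_inj (inv_inj hK)).
Qed.

(** With the coordinates outside [S] frozen, a character becomes, up to sign, the character of
    [restrict u S]; the weight of the latter is thus its degree in the variables of [S]. *)
Lemma chi_patch u x y :
  chi R u (patch x y) =
    (\prod_(i | i \notin (elt S @: 'I_m)%SET) (-1) ^+ (u i && x i))
    * chi R (restrict u S) y.
Proof.
rewrite /chi (bigID (mem (elt S @: 'I_m)%SET)) /= mulrC; congr (_ * _).
  apply: eq_bigr => i ni; rewrite patch_out // => k; apply: contraNneq ni => <-.
  exact: imset_f.
rewrite big_imset /=; last by move=> i j _ _; exact: elt_inj.
by apply: eq_bigr => k _; rewrite patch_elt ffunE.
Qed.

End Patch.

(** * Pseudo-densities and random subsets *)

Section LowDegreeSquares.
Variables (R : realType) (n m d : nat) (D : cube m -> R) (S : msubsets n m).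
Hypothesis Dpd : pseudo_density d D.
Variables (c : cube n -> R).

Let high : pred (cube n) := fun u => (d < (weight (restrict u S)).*2)%N.
Let f x := \sum_u c u * chi R u x.
Let lo x := \sum_(u | ~~ high u) c u * chi R u x.
Let hi x := \sum_(u | high u) c u * chi R u x.

(** For each fixing of the coordinates outside [S], [lo] is a function of [x_S] of degree at most
    d/2, and the pseudo-density condition applies to it. *)
Lemma mean_low_ge0 : 0 <= mean (fun x => D (restrict x S) * lo x ^+ 2).
Proof.
rewrite (mean_patch S); apply: mean_ge0 => x.
pose b u := c u * \prod_(i | i \notin (elt S @: 'I_m)%SET) (-1) ^+ (u i && x i).
under eq_mean => y do rewrite restrict_patch.
pose g y := \sum_(u | ~~ high u) b u * chi R (restrict u S) y.
have gE y : lo (patch S x y) = g y.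
  by apply: eq_bigr => u _; rewrite chi_patch mulrA.
under eq_mean => y do rewrite gE.
apply: Dpd.2; apply: (@le_trans _ _ (d./2)%:R).
  rewrite ler_nat; apply: cube_deg_chi_sum => u.
  by rewrite /high -leqNgt => /half_leq; rewrite doubleK.
by rewrite ler_pdivlMr // -natrM ler_nat muln2 -[leqRHS]odd_double_half leq_addl.
Qed.

(** Replacing [f] by [lo] changes the square by [2 f hi - hi^2], which is at most
    [tau f^2 + (1 + tau^-1) hi^2] in absolute value; Parseval evaluates the mean of [hi ^+ 2]. *)
Lemma mean_sqr_lower (tau : R) : 0 < tau ->
  - (max_norm D * (tau * mean (fun x => f x ^+ 2)
      + (1 + tau^-1) * \sum_(u | high u) c u ^+ 2))
  <= mean (fun x => D (restrict x S) * f x ^+ 2).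
Proof.
move=> tau0; rewrite -parseval -/hi.
have fE x : f x = lo x + hi x by rewrite /f (bigID high) addrC.
have D0 : 0 <= max_norm D.
  by apply: le_trans (le_max_norm D [ffun=> false]); rewrite normr_ge0.
rewrite -subr_ge0 opprK.
apply: le_trans mean_low_ge0 _.
rewrite -!meanZ -meanD -meanZ -meanD; apply: ler_mean => x; rewrite fE.
set a := lo x; set b := hi x; set e := D _.
have := le_max_norm D (restrict x S); rewrite -/e; set M := max_norm D in D0 *.
rewrite ler_norml => /andP[e1 e2].
have h1 : `|(a + b) ^+ 2 - a ^+ 2| <= tau * (a + b) ^+ 2 + (1 + tau^-1) * b ^+ 2.
  have p : 0 <= tau^-1 * (tau * (a + b) - b) ^+ 2.
    by rewrite mulr_ge0 ?sqr_ge0 // invr_ge0 ltW.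
  have q : 0 <= tau^-1 * (tau * (a + b) + b) ^+ 2.
    by rewrite mulr_ge0 ?sqr_ge0 // invr_ge0 ltW.
  have pE : tau^-1 * (tau * (a + b) - b) ^+ 2 =
      tau * (a + b) ^+ 2 - 2 * (a + b) * b + tau^-1 * b ^+ 2 by field; rewrite gt_eqF.
  have qE : tau^-1 * (tau * (a + b) + b) ^+ 2 =
      tau * (a + b) ^+ 2 + 2 * (a + b) * b + tau^-1 * b ^+ 2 by field; rewrite gt_eqF.
  have b2 : 0 <= b ^+ 2 by exact: sqr_ge0.
  rewrite pE in p; rewrite qE in q.
  rewrite ler_norml; apply/andP; split; lra.
move: h1; set X := tau * _ + _; rewrite ler_norml => /andP[h1 h2].
nra.
Qed.

End LowDegreeSquares.

(** * How a random subset meets a fixed set *)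

Section RandomSubset.
Variables (R : realType) (n m : nat).

Lemma card_msubsets : #|{: msubsets n m}| = 'C(n, m).
Proof.
rewrite card_sig -[in RHS](card_ord n) -card_draws cardsE.
by apply: eq_card => A; rewrite !inE.
Qed.

Lemma card_msubsets_sup (T : {set 'I_n}) :
  (#|[pred S : msubsets n m | T \subset val S]| <= 'C(n - #|T|, m - #|T|))%N.
Proof.
pose h (S : msubsets n m) : {set 'I_n} := (val S :\: T)%SET.
have inj : {in [pred S : msubsets n m | T \subset val S] &, injective h}.
  move=> S1 S2; rewrite !inE => T1 T2 e; apply: val_inj.
  rewrite -(finset.setID (val S1) T) -(finset.setID (val S2) T).
  by rewrite (finset.setIidPr T1) (finset.setIidPr T2) [X in T :|: X]e.
rewrite -(card_in_imset inj).
have <- : #|(~: T)%SET| = (n - #|T|)%N by rewrite cardsCs finset.setCK card_ord.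
rewrite -cards_draws; apply/subset_leq_card/fintype.subsetP => A.
move=> /imsetP[S TS ->]; rewrite !inE in TS *.
rewrite /h finset.setDE finset.subsetIr /= -finset.setDE cardsD (eqP (valP S)).
by rewrite (finset.setIidPr TS).
Qed.

(** A random [m]-set contains a given [e]-set with probability at most (m/n)^e: each step of the
    induction costs (m-e)/(n-e), which is at most m/n. *)
Lemma bin_sub_le e : (e <= m)%N -> (m <= n)%N ->
  ('C(n - e, m - e) * n ^ e <= m ^ e * 'C(n, m))%N.
Proof.
elim: e => [|e IH] em mn; first by rewrite !subn0 muln1 mul1n.
have IHe := IH (ltnW em) mn.
have en : (0 < n - e)%N by rewrite subn_gt0; exact: leq_trans em mn.
have := mul_bin_diag (n - e) (m - e.+1); rewrite -subnS subnSK // => E.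
rewrite -(leq_pmul2l en) mulnA E expnS.
have -> : ((m - e) * 'C(n - e, m - e) * (n * n ^ e) =
  (m - e) * n * ('C(n - e, m - e) * n ^ e))%N by rewrite mulnACA.
have -> : ((n - e) * (m ^ e.+1 * 'C(n, m)) = m * (n - e) * (m ^ e * 'C(n, m)))%N.
  by rewrite expnS -[(m * m ^ e * _)%N]mulnA mulnA [((n - e) * m)%N]mulnC.
apply: leq_mul => //; rewrite mulnBl mulnBr leq_sub2l //.
by rewrite mulnC leq_mul2l mn orbT.
Qed.

Lemma bin_le_exp a e : ('C(a, e) <= a ^ e)%N.
Proof.
apply: (@leq_trans (a ^_ e)); first by rewrite -bin_ffact leq_pmulr // fact_gt0.
rewrite ffact_prod -[X in (_ <= _ ^ X)%N]card_ord -prod_nat_const.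
by apply: leq_prod => i _; exact: leq_subr.
Qed.

(** A union bound over the [e]-subsets of the support of [u]. *)
Lemma mean_weight_restrict e (u : cube n) : (m <= n)%N -> (0 < n)%N ->
  mean (fun S : msubsets n m => (e <= weight (restrict u S))%N%:R : R)
  <= ((weight u)%:R * m%:R / n%:R) ^+ e.
Proof.
move=> mn n0.
have rhs0 : 0 <= ((weight u)%:R * m%:R / n%:R) ^+ e :> R.
  by rewrite exprn_ge0 // divr_ge0 ?mulr_ge0 ?ler0n.
have [em|me] := leqP e m; last first.
  rewrite (_ : mean _ = 0) // /mean big1 ?mul0r // => S _.
  suff -> : (e <= weight (restrict u S))%N = false by [].
  apply/negbTE; rewrite -ltnNge; apply: leq_ltn_trans me.
  rewrite -[X in (_ <= X)%N]card_ord -sum1_card.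
  by apply: leq_sum => k _; exact: leq_b1.
pose U : {set 'I_n} := finset.finset (fun i => u i).
have cU : #|U| = weight u.
  by rewrite -sum1_card big_mkcond; apply: eq_bigr => i _; rewrite inE; case: (u i).
pose Ts : {set {set 'I_n}} :=
  finset.finset (fun T : {set 'I_n} => (T \subset U) && (#|T| == e)).
have bound (S : msubsets n m) :
    ((e <= weight (restrict u S)) <= \sum_(T in Ts) (T \subset val S))%N.
  have [h|//] := leqP e (weight (restrict u S)).
  pose X : {set 'I_n} := (elt S @: finset.finset (fun k => u (elt S k)))%SET.
  have cX : #|X| = weight (restrict u S).
    rewrite card_imset; last exact: elt_inj.
    rewrite -sum1_card big_mkcond; apply: eq_bigr => i _.
    by rewrite inE ffunE; case: (u _).
  move: h; rewrite -cX => /card_geqP[s [us ss sX]].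
  pose T : {set 'I_n} := finset.finset (mem s).
  have TX i : i \in T -> i \in X by rewrite inE => /sX.
  have TTs : T \in Ts.
    rewrite inE; apply/andP; split.
      apply/fintype.subsetP => i /TX /imsetP[k]; rewrite !inE => uk ->.
      by [].
    by rewrite cardsE (card_uniqP us) ss.
  rewrite (bigD1 T) //=.
  have -> : T \subset val S; last by rewrite leq_addr.
  by apply/fintype.subsetP => i /TX /imsetP[k _ ->]; exact: elt_mem.
have cnt : (\sum_(S : msubsets n m) (e <= weight (restrict u S))
     <= 'C(weight u, e) * 'C(n - e, m - e))%N.
  apply: (@leq_trans (\sum_(S : msubsets n m) \sum_(T in Ts) (T \subset val S))%N).
    by apply: leq_sum => S _; exact: bound.
  rewrite exchange_big /= -cU -cards_draws -sum_nat_const.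
  apply: leq_sum => T; rewrite inE => /andP[_ /eqP <-].
  apply: leq_trans (card_msubsets_sup T); rewrite -sum1_card [leqRHS]big_mkcond.
  by apply: leq_sum => S _; rewrite inE; case: (_ \subset _).
have C0 : (0 < 'C(n, m))%N by rewrite bin_gt0.
rewrite /mean card_msubsets ler_pdivrMr ?ltr0n // -natr_sum.
rewrite -natrM expr_div_n mulrAC ler_pdivlMr ?exprn_gt0 ?ltr0n //.
rewrite -!natrX -!natrM ler_nat.
apply: (@leq_trans ('C(weight u, e) * 'C(n - e, m - e) * n ^ e)%N).
  by rewrite leq_mul2r cnt orbT.
rewrite expnMn -!mulnA; apply: leq_mul; first exact: bin_le_exp.
exact: bin_sub_le.
Qed.

End RandomSubset.

(** * The moment argument *)

Section Core.
Variables (R : realType) (n m d r k : nat) (D : cube m -> R).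
Variables (P : msubsets n m -> 'M[R]_r.+1) (Q : cube n -> 'M[R]_r.+1).
Variables (lam K : R).
Hypothesis lam0 : 0 <= lam.
Hypothesis mn : (m <= n)%N.
Hypothesis n0 : (0 < n)%N.
Hypothesis Dpd : pseudo_density d D.
Hypothesis Ppsd : forall S, psdmx (P S).
Hypothesis Qpsd : forall x, psdmx (Q x).
Hypothesis Pmean : psdmx (1%:M - #|{: msubsets n m}|%:R^-1 *: \sum_S P S).
Hypothesis Plam : forall S, psdmx (lam%:M - P S).
Hypothesis Qtr : forall x, \tr (Q x) <= K.

Let Del := max_norm D.
Let c := #|{: msubsets n m}|%:R^-1 : R.

Definition avg_mx x := c *: \sum_S D (restrict x S) *: P S.
Let F := avg_mx.
Definition gap_mx x := 1%:M - Del^-1 *: F x.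
Let G := gap_mx.
Let M j := mean (fun x => \tr (G x ^+ j)).
(** The bound of [mean_weight_restrict] for weight [k * m]; [d./2.+1] is the least integer exceeding
    d/2. *)
Let eta : R := ((k * m)%:R * m%:R / n%:R) ^+ d./2.+1.

Lemma max_norm_density_ge1 : 1 <= Del.
Proof.
rewrite -{1}Dpd.1 -(mean_const (cube0 m) Del).
by apply: ler_mean => x; apply: le_trans (ler_norm _) (le_max_norm D x).
Qed.

Let Del0 : 0 < Del.
Proof. exact: lt_le_trans ltr01 max_norm_density_ge1. Qed.

Lemma tr_avg_mx x (B : 'M[R]_r.+1) :
  \tr (F x *m B) = mean (fun S => D (restrict x S) * \tr (P S *m B)).
Proof.
rewrite /F /avg_mx -scalemxAl linearZ /= mulmx_suml linear_sum /= /mean mulrC.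
congr (_ / _); apply: eq_bigr => S _.
by rewrite -scalemxAl linearZ.
Qed.

(** [G x] is [1 - E_S P_S] plus the mean over [S] of [(1 - D / Del) P_S], and [D] never exceeds
    [Del]. *)
Lemma psdmx_gap x : psdmx (G x).
Proof.
have -> : G x = (1%:M - c *: \sum_S P S)
    + c *: \sum_S (1 - Del^-1 * D (restrict x S)) *: P S.
  rewrite /G /gap_mx /F /avg_mx -addrA; congr (_ + _).
  have -> : \sum_S (1 - Del^-1 * D (restrict x S)) *: P S =
      \sum_S P S - Del^-1 *: \sum_S D (restrict x S) *: P S.
    rewrite scaler_sumr -sumrB; apply: eq_bigr => S _.
    by rewrite scalerBl scale1r scalerA.
  by rewrite scalerBr addKr !scalerA mulrC.
apply: psdmxD => //; apply: psdmxZ; first by rewrite invr_ge0 ler0n.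
apply: psdmx_sum => S; apply: psdmxZ => //.
rewrite subr_ge0 mulrC ler_pdivrMr // mul1r.
exact: le_trans (ler_norm _) (le_max_norm D _).
Qed.

Lemma fourier_deg_gap_exp :
  fourier_deg_le (k * m) (fun x => G x ^+ k).
Proof.
apply: fourier_degX.
apply: (@eq_fourier_deg _ _ _ _ (fun x => 1%:M + \sum_S
   (- (Del^-1 * c * D (restrict x S))) *: P S)) => [x|].
  rewrite /G /gap_mx /F /avg_mx scalerA scaler_sumr -sumrN; congr (_ + _).
  by apply: eq_bigr => S _; rewrite scalerA scaleNr.
apply: fourier_degD; first exact: fourier_deg_leW (fourier_deg_const _ _).
apply: fourier_deg_sum => S.
exact: (fourier_deg_restrict S (fun y => - (Del^-1 * c * D y))).
Qed.

Lemma tr_gram_sum p q (B : 'M[R]_(p, q)) :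
  \tr (B *m B^T) = \sum_i \sum_j B i j ^+ 2.
Proof.
apply: eq_bigr => i _; rewrite mxE; apply: eq_bigr => j _.
by rewrite [X in _ * X]mxE expr2.
Qed.

Let GT x j : (G x ^+ j)^T = G x ^+ j.
Proof. by case: (psdmx_exp (psdmx_gap x) j). Qed.

(** With [P S = L *m L^T], the trace against [G ^+ k.*2] is the sum of the squared entries of
    [G ^+ k *m L]. [mean_sqr_lower] applies to each entry, and averaging over [S] makes the
    high-degree part small. *)
Lemma gap_test_lower tau : 0 < tau ->
  - (Del * (tau + (1 + tau^-1) * (lam * eta)) * M k.*2)
  <= mean (fun x => \tr (F x *m G x ^+ k.*2)).
Proof.
move=> tau0.
have [C [C0 CE]] := fourier_deg_gap_exp.
have GG x : G x ^+ k.*2 = G x ^+ k *m G x ^+ k by rewrite -addnn exprD.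
have taup : 0 <= 1 + tau^-1 by rewrite addr_ge0 // invr_ge0 ltW.
under [X in _ <= X]eq_mean => x do rewrite tr_avg_mx.
rewrite exchange_mean.
pose hi (S : msubsets n m) u := (d < (weight (restrict u S)).*2)%N.
pose Cn u := \tr (C u *m (C u)^T).
have Cn0 u : 0 <= Cn u by exact: psdmx_trace_ge0 (psdmx_gram _).
have lower S : - (Del * (tau * mean (fun x => \tr (P S *m G x ^+ k.*2))
      + (1 + tau^-1) * (lam * \sum_(u | hi S u) Cn u)))
    <= mean (fun x => D (restrict x S) * \tr (P S *m G x ^+ k.*2)).
  have [L LE] := psdmx_cholesky (Ppsd S).
  have trE x : \tr (P S *m G x ^+ k.*2) =
      \sum_a \sum_b (\sum_u (C u *m L) a b * chi R u x) ^+ 2.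
    have -> : \tr (P S *m G x ^+ k.*2) = \tr ((G x ^+ k *m L) *m (G x ^+ k *m L)^T).
      rewrite trmx_mul GT GG LE mulmxA mxtrace_mulC.
      by rewrite !mulmxA.
    rewrite tr_gram_sum; apply: eq_bigr => a _; apply: eq_bigr => b _.
    congr (_ ^+ 2); rewrite CE mulmx_suml summxE; apply: eq_bigr => u _.
    by rewrite -scalemxAl mxE mulrC.
  have step a b := mean_sqr_lower S Dpd (fun u => (C u *m L) a b) tau0.
  apply: (@le_trans _ _ (\sum_a \sum_b - (max_norm D * (tau * mean
     (fun x => (\sum_u (C u *m L) a b * chi R u x) ^+ 2) + (1 + tau^-1) *
       \sum_(u | hi S u) (C u *m L) a b ^+ 2)))); last first.
    under [X in _ <= X]eq_mean => x.
      rewrite trE mulr_sumr; under eq_bigr => a _ do rewrite mulr_sumr; over.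
    rewrite mean_sum; apply: ler_sum => a _; rewrite mean_sum.
    by apply: ler_sum => b _; exact: step.
  under [X in _ <= X]eq_bigr => a _ do rewrite sumrN -mulr_sumr big_split -!mulr_sumr /=.
  rewrite sumrN -mulr_sumr big_split -!mulr_sumr /= lerN2 ler_pM2l //.
  have -> : mean (fun x => \tr (P S *m G x ^+ k.*2)) = \sum_a \sum_b mean
      (fun x => (\sum_u (C u *m L) a b * chi R u x) ^+ 2).
    rewrite (eq_mean trE) mean_sum; apply: eq_bigr => a _.
    by rewrite mean_sum.
  rewrite lerD2l; apply: ler_wpM2l => //.
  (* The squared Frobenius norm of [C u *m L] is the trace of [P S] against [(C u)^T *m C u], hence
     at most [lam * Cn u]. *)
  under eq_bigr do rewrite exchange_big.
  rewrite exchange_big mulr_sumr /=; apply: ler_sum => u _.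
  rewrite -tr_gram_sum trmx_mul mulmxA -[C u *m L *m _]mulmxA -LE.
  rewrite -mulmxA mxtrace_mulC -mulmxA.
  have -> : lam * Cn u = \tr (lam%:M *m ((C u)^T *m C u)).
    by rewrite mul_scalar_mx linearZ /= /Cn mxtrace_mulC.
  apply: psdmx_tr_le => //.
  by have := psdmx_gram (C u)^T; rewrite trmxK.
apply: le_trans (ler_mean lower).
rewrite meanN lerN2 meanZ meanD !meanZ -mulrA ler_pM2l //.
rewrite [X in _ <= X]mulrDl; apply: lerD.
  rewrite ler_pM2l // exchange_mean; apply: ler_mean => x.
  have -> : mean (fun S => \tr (P S *m G x ^+ k.*2))
      = \tr ((c *: \sum_S P S) *m G x ^+ k.*2).
    rewrite -scalemxAl linearZ /= mulmx_suml linear_sum /mean /= mulrC.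
    by [].
  rewrite -[X in _ <= \tr X]mul1mx; apply: psdmx_tr_le => //.
  exact/psdmx_exp/psdmx_gap.
rewrite -[X in _ <= X]mulrA -[lam * eta * _]mulrA; apply: ler_wpM2l => //.
apply: ler_wpM2l => //.
(* Parseval, entry by entry. *)
have -> : M k.*2 = \sum_u Cn u.
  rewrite /Cn; under [RHS]eq_bigr do rewrite tr_gram_sum.
  rewrite exchange_big /=; under [RHS]eq_bigr do rewrite exchange_big /=.
  have trE x : \tr (G x ^+ k.*2) =
      \sum_a \sum_b (\sum_u C u a b * chi R u x) ^+ 2.
    rewrite GG -{2}GT tr_gram_sum; apply: eq_bigr => a _; apply: eq_bigr => b _.
    congr (_ ^+ 2); rewrite CE summxE; apply: eq_bigr => u _.
    by rewrite mxE mulrC.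
  rewrite /M (eq_mean trE) mean_sum; apply: eq_bigr => a _.
  by rewrite mean_sum; apply: eq_bigr => b _; rewrite parseval.
under eq_mean => S do rewrite big_mkcond.
rewrite mean_sum mulr_sumr; apply: ler_sum => u _.
have [uk|ku] := leqP (weight u) (k * m); last first.
  rewrite /Cn C0 // mul0mx linear0 mulr0.
  by under eq_mean => S do rewrite if_same; rewrite /mean big1 ?mul0r.
have hiE S : (if hi S u then Cn u else 0) = Cn u * (hi S u)%:R.
  by case: ifP; rewrite ?mulr1 ?mulr0.
rewrite (eq_mean hiE) meanZ mulrC; apply: ler_wpM2r => //.
apply: le_trans (_ : ((weight u)%:R * m%:R / n%:R) ^+ d./2.+1 <= _).
  apply: le_trans (mean_weight_restrict _ _ u mn n0); apply: ler_mean => S.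
  by rewrite /hi -ltn_half_double.
rewrite /eta lerXn2r // ?nnegrE ?divr_ge0 ?mulr_ge0 ?ler0n //.
by rewrite ler_wpM2r ?invr_ge0 ?ler0n // ler_wpM2r ?ler0n // ler_nat.
Qed.

(** [gap_test_lower] bounds the moment of order [k.*2.+1] by [1 + delta] times the previous one.
    Inserting this in [tr_exp_le] at [t = 1 + delta] cancels all but one copy of the moment of order
    [k.*2]. *)
Lemma gap_moment_le tau delta : 0 < tau ->
  delta = tau + (1 + tau^-1) * (lam * eta) ->
  M k.*2 <= (1 + delta) ^+ k.*2 * r.+1%:R.
Proof.
move=> tau0 dE; have h := gap_test_lower tau0; rewrite -dE in h.
have eta0 : 0 <= eta by rewrite exprn_ge0 // divr_ge0 ?mulr_ge0 ?ler0n.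
have d0 : 0 <= delta.
  by rewrite dE addr_ge0 ?mulr_ge0 ?addr_ge0 ?invr_ge0 ?(ltW tau0).
have step : M k.*2.+1 <= (1 + delta) * M k.*2.
  have -> : M k.*2.+1 = M k.*2 - Del^-1 * mean (fun x => \tr (F x *m G x ^+ k.*2)).
    rewrite -meanZ -meanN -meanD; apply: eq_mean => x.
    rewrite exprS -[_ * _]/(G x *m _) {1}/G /gap_mx mulmxBl mul1mx -scalemxAl.
    by rewrite linearB linearZ.
  rewrite mulrDl mul1r lerD2l lerNl ler_pdivlMl //.
  by rewrite mulrN mulrA.
set j := k.*2 in step *; set t := 1 + delta in step *.
have t0 : 0 < t by rewrite /t; lra.
have avg : j.+1%:R * t * M j <= j%:R * M j.+1 + t ^+ j.+1 * r.+1%:R.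
  rewrite -!meanZ -[X in _ <= _ + X](mean_const (cube0 n)) -meanD.
  by apply: ler_mean => x; apply: tr_exp_le; [exact: psdmx_gap|exact: ltW].
rewrite -(ler_pM2l t0) [X in _ <= X]mulrA -exprS.
have : j%:R * M j.+1 <= j%:R * (t * M j) by rewrite ler_wpM2l ?ler0n.
have : j.+1%:R * t * M j = j%:R * (t * M j) + t * M j.
  by rewrite -[j.+1%:R]natr1 mulrDl mul1r mulrDl mulrA.
move: avg; move: (j.+1%:R * _ * _) (j%:R * M _) (j%:R * (_ * _)) => *; lra.
Qed.

Lemma LD_lower (sigma tau delta : R) : (0 < k)%N -> 0 < sigma -> 0 < tau ->
  delta = tau + (1 + tau^-1) * (lam * eta) ->
  - (K * (Del * sigma + Del * (1 + sigma) / k.*2%:R * r.+1%:R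
        * ((1 + delta) / (1 + sigma)) ^+ k.*2))
  <= LD D (fun S x => \tr (P S *m Q x)).
Proof.
move=> k0 s0 tau0 dE; have Mle := gap_moment_le tau0 dE.
set t := 1 + sigma; have t0 : 0 < t by rewrite /t; lra.
have K0 : 0 <= K by apply: le_trans (Qtr (cube0 n)); exact: psdmx_trace_ge0.
have -> : LD D (fun S x => \tr (P S *m Q x)) = mean (fun x => \tr (F x *m Q x)).
  by apply: eq_mean => x; rewrite tr_avg_mx.
have [j jE] : exists j, k.*2 = j.+1 by case: (k) k0 => // l _; exists l.*2.+1.
(* Normalized so that the linear term of the tangent inequality, times [a], is [Del *: G x], that is
   [Del - F x]. *)
pose a := Del / (j.+1%:R * t ^+ j).
have j0 : 0 < j.+1%:R :> R by rewrite ltr0n.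
have tj0 : 0 < t ^+ j by rewrite exprn_gt0.
have a0 : 0 < a by rewrite divr_gt0 // mulr_gt0.
have pt x : - \tr (F x *m Q x) <= K * (Del * sigma + a * \tr (G x ^+ j.+1)).
  have Gpsd := psdmx_gap x.
  have Z := psdmx_tangent Gpsd j (ltW t0).
  have := psdmx_tr_mul_ge0 (psdmxZ (ltW a0) Z) (Qpsd x).
  rewrite scalerDr scalerBr scalerA scale_scalar_mx.
  have -> : a * (j.+1%:R * t ^+ j) = Del by rewrite divfK // gt_eqF // mulr_gt0.
  have -> : Del *: G x = Del%:M - F x.
    by rewrite scalerBr scalemx1 scalerA divff ?scale1r // gt_eqF.
  have bE : a * (j%:R * t ^+ j.+1) <= Del * t.
    have -> : a * (j%:R * t ^+ j.+1) = Del * t * (j%:R / j.+1%:R).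
      rewrite /a exprS; move: (j.+1%:R) (t ^+ j) (j0) (tj0) => J p J0 p0.
      by field; rewrite !gt_eqF.
    rewrite -[leRHS]mulr1 ler_pM2l ?mulr_gt0 //.
    by rewrite ler_pdivrMr // mul1r ler_nat.
  move: bE; set b := a * (j%:R * _) => bE.
  rewrite mulmxDl mulmxBl mulmxBl -scalemxAl !mul_scalar_mx.
  rewrite linearD !linearB !linearZ /=.
  set q := \tr (Q x); set f := \tr (F x *m Q x); set g := \tr (_ *m Q x).
  have q0 : 0 <= q by exact: psdmx_trace_ge0.
  (* [Q x] is dominated by its trace, hence by [K]. *)
  have gK : g <= K * \tr (G x ^+ j.+1).
    rewrite /g mxtrace_mulC -[K * _]linearZ /= -mul_scalar_mx.
    apply: psdmx_tr_le; last exact: psdmx_exp.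
    rewrite -[X in X - _](subrK q%:M) -addrA; apply: psdmxD.
      by rewrite -raddfB; apply: psdmx_scalar; rewrite subr_ge0; exact: Qtr.
    exact: psdmx_le_trace.
  have h1 : a * g <= a * (K * \tr (G x ^+ j.+1)) by rewrite ler_pM2l.
  have h2 : b * q <= Del * t * q by rewrite ler_wpM2r.
  have h3 : Del * sigma * q <= Del * sigma * K.
    by rewrite ler_wpM2l ?mulr_ge0 ?(ltW Del0) ?(ltW s0) //; exact: Qtr.
  have h4 : Del * t * q = Del * q + Del * sigma * q by rewrite /t; ring.
  by rewrite mulrDr ![K * _]mulrC -![_ * _ * K]mulrA [_ * K]mulrC; lra.
rewrite lerNl -meanN.
apply: le_trans (ler_mean pt) _.
rewrite meanZ ler_wpM2l // meanD (mean_const (cube0 n)) meanZ lerD2l.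
apply: (@le_trans _ _ (a * ((1 + delta) ^+ k.*2 * r.+1%:R))).
  by rewrite ler_pM2l // -jE.
rewrite jE /a expr_div_n [t ^+ j.+1]exprS le_eqVlt; apply/orP; left; apply/eqP.
move: ((1 + delta) ^+ j.+1) (r.+1%:R) => w s.
move: (j.+1%:R) (t ^+ j) (j0) (tj0) => J p J0 p0.
by field; rewrite !gt_eqF.
Qed.

End Core.

(** * Choice of the parameters *)

Section ParameterChoice.
Variable R : realType.

(** From [1 - 1/2 <= exp (- 1/2)]. *)
Lemma ln2_ge_half : 2^-1 <= ln 2 :> R.
Proof.
have h := expR_ge1Dx (- 2^-1 : R).
have e0 := expR_gt0 (2^-1 : R).
rewrite -[leLHS]expRK ler_ln ?posrE //.
rewrite expRN -(ler_pM2l e0) mulfV ?gt_eqF // in h.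
lra.
Qed.

Variables (n m d r : nat) (C c0 eps Del : R).
Hypotheses (n2 : (2 <= n)%N) (m0 : (0 < m)%N) (d0 : (0 < d)%N) (r0 : (0 < r)%N).
Hypotheses (C0 : 0 < C) (c0_gt0 : 0 < c0) (c0_le : c0 <= 11520^-1).
Hypothesis CE : 48 * C = c0 ^+ 2.
Hypotheses (eps0 : 0 < eps) (eps1 : eps <= 1) (Del1 : 1 <= Del).
Hypothesis hr : r%:R ^+ 2 <=
  (C * eps / (d%:R * m%:R ^+ 2 * Del)) `^ (d%:R / 2) * (eps / Del) ^+ 3
  * (n%:R / ln n%:R) `^ (d%:R / 2).

(** The right side of [hr] is [(C w)^(d/2) (eps / Del)^3]. *)
Let w := eps * n%:R / (d%:R * m%:R ^+ 2 * Del * ln n%:R).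

Let n0 : 0 < n%:R :> R. Proof. by rewrite ltr0n; apply: leq_trans n2. Qed.
Let mR : 1 <= m%:R :> R. Proof. by rewrite ler1n. Qed.
Let dR : 1 <= d%:R :> R. Proof. by rewrite ler1n. Qed.
Let rR : 1 <= r%:R :> R. Proof. by rewrite ler1n. Qed.

Let lnn : 2^-1 <= ln n%:R :> R.
Proof.
by apply: le_trans ln2_ge_half _; rewrite ler_ln ?posrE // ?ltr0n ?(ltnW n2) // ler_nat.
Qed.

Let mP : 0 < m%:R :> R. Proof. by rewrite ltr0n. Qed.
Let dP : 0 < d%:R :> R. Proof. by rewrite ltr0n. Qed.
Let DP : 0 < Del. Proof. exact: lt_le_trans Del1. Qed.
Let lP : 0 < ln n%:R :> R. Proof. by apply: lt_le_trans lnn; rewrite invr_gt0. Qed.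

Let w0 : 0 < w.
Proof. by rewrite divr_gt0 ?mulr_gt0 ?exprn_gt0. Qed.

Let ratio0 : 0 < eps / Del. Proof. by rewrite divr_gt0. Qed.
Let ratio1 : eps / Del <= 1.
Proof. by rewrite ler_pdivrMr // mul1r; exact: le_trans eps1 Del1. Qed.

Let rw : r%:R ^+ 2 <= (C * w) `^ (d%:R / 2) * (eps / Del) ^+ 3.
Proof.
apply: le_trans hr _; rewrite mulrAC -powRM; last 2 first.
- by apply: ltW; rewrite divr_gt0 ?mulr_gt0 ?exprn_gt0.
- by apply: ltW; rewrite divr_gt0.
rewrite le_eqVlt; apply/orP; left; apply/eqP; congr (_ `^ _ * _).
by rewrite /w; field; rewrite !gt_eqF.
Qed.

Let rw1 : r%:R ^+ 2 <= (C * w) `^ (d%:R / 2).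
Proof.
apply: le_trans rw _; rewrite -[leRHS]mulr1 ler_wpM2l ?powR_ge0 //.
by rewrite exprn_ile1 // ltW.
Qed.

Let d2 : 0 < d%:R / 2 :> R. Proof. by rewrite divr_gt0. Qed.

(** Otherwise the hypothesis would force [r < 1]; so [n] is large compared with the other
    parameters. *)
Let Cw1 : 1 <= C * w.
Proof.
rewrite leNgt; apply/negP => lt1.
have : (C * w) `^ (d%:R / 2) < 1.
  have E1 : 1 `^ (d%:R / 2) = 1 :> R by rewrite powR1.
  rewrite -[ltRHS]E1.
  by apply: (gt0_ltr_powR d2) => //; rewrite nnegrE ?ler01 // ltW // mulr_gt0.
by rewrite ltNge => /negP; apply; apply: le_trans rw1; rewrite exprn_ege1.
Qed.

Let C48 : C <= 48^-1.
Proof.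
have h : c0 ^+ 2 <= 1.
  rewrite exprn_ile1 ?(ltW c0_gt0) //; apply: le_trans c0_le _.
  by rewrite invf_le1 ?ler1n ?ltr0n.
by move: h; rewrite -CE; lra.
Qed.

(** [C * w] is at most [n], as [C * eps] is at most one half and hence at most [ln n%:R]. A
    polynomial bound on [r] is what lets [k] be logarithmic in [n]. *)
Let rn : r%:R <= n%:R ^+ d :> R.
Proof.
apply: (@le_trans _ _ (r%:R ^+ 2)).
  by rewrite expr2 ler_peMr // ltW // (lt_le_trans ltr01).
apply: le_trans rw1 _; rewrite -powR_mulrn ?ler0n //.
have nd : 1 <= n%:R :> R by rewrite ler1n (ltnW n2).
apply: (@le_trans _ _ (n%:R `^ (d%:R / 2))); last first.
  by apply: ler_powR => //; rewrite ler_pdivrMr // ler_peMr ?ler1n ?ltW.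
apply: (ge0_ler_powR (ltW d2)); rewrite ?nnegrE.
- by rewrite ltW // mulr_gt0.
- exact: ltW.
rewrite /w mulrA ler_pdivrMr ?mulr_gt0 ?exprn_gt0 //.
rewrite mulrA mulrC ler_pM2l //.
apply: (@le_trans _ _ 2^-1).
  rewrite -[leRHS]mulr1; apply: ler_pM => //; [exact: ltW|exact: ltW|].
  by have := C48; lra.
apply: le_trans lnn _; rewrite ler_peMl ?(ltW lP) //.
have h1 : 1 <= d%:R * m%:R ^+ 2 :> R by rewrite mulr_ege1 // exprn_ege1.
exact: mulr_ege1.
Qed.

(** [sigma] makes [Del * sigma] equal to eps/12; [X] makes [exp (- X sigma / 2)] equal to
    [n^(-d)]. *)
Let sigma := eps / (12 * Del).
Let X := 2 * d%:R * ln n%:R / sigma.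
Let k := (Num.truncn X).+1.

Let sigma0 : 0 < sigma. Proof. by rewrite divr_gt0 // mulr_gt0. Qed.

Let sigmaE : sigma = (eps / Del) / 12.
Proof. by rewrite /sigma; field; rewrite gt_eqF. Qed.

Let sigma1 : sigma <= 1.
Proof. by rewrite sigmaE; have := ratio1; have := ratio0; lra. Qed.

Let dln : 1 <= 2 * d%:R * ln n%:R :> R.
Proof.
have := lnn; have := dR; move: (ln _) d%:R => l e he hl; nra.
Qed.

Let X1 : sigma^-1 <= X.
Proof. by rewrite /X ler_peMl // invr_ge0 ltW. Qed.

Let XS : 1 <= X.
Proof. by apply: le_trans X1; rewrite invf_ge1. Qed.

Let kX : X < k%:R. Proof. exact: truncnS_gt. Qed.

Let kX2 : k%:R <= 2 * X.
Proof.
have /andP[h _] := truncn_itv (le_trans ler01 XS).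
by rewrite /k -natr1; have := XS; lra.
Qed.

Let kP : 0 < k%:R :> R. Proof. by rewrite ltr0n. Qed.

Let eta_le : ((k * m)%:R * m%:R / n%:R) ^+ d./2.+1 <= (48 / w) `^ (d%:R / 2).
Proof.
have y0 : 0 <= (k * m)%:R * m%:R / n%:R :> R by rewrite divr_ge0 ?mulr_ge0 ?ler0n.
have yw : (k * m)%:R * m%:R / n%:R <= 48 / w.
  (* The constant 48 is 2 * 2 * 12: from [k <= 2 X], from [X] and from [sigma]. *)
  have -> : 48 / w = (2 * X) * m%:R * m%:R / n%:R.
    by rewrite /X /sigma /w; field; rewrite !gt_eqF.
  by rewrite natrM !ler_pM2r ?invr_gt0.
have w1 : 0 < 48 / w <= 1.
  rewrite divr_gt0 //= ler_pdivrMr // mul1r.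
  have := Cw1; have := C48; have := w0; have := C0; move: (w) => v ? ? ?; nra.
apply: (@le_trans _ _ ((48 / w) ^+ d./2.+1)).
  by rewrite lerXn2r // ?nnegrE // ltW //; case/andP: w1.
rewrite -powR_mulrn; last by case/andP: w1 => /ltW.
(* The base is at most 1, so passing from the exponent [d./2.+1] down to d/2 only increases the
   power. *)
apply: (ger_powR w1); rewrite ler_pdivrMr // -natrM ler_nat.
rewrite -[leqLHS]odd_double_half -muln2 mulSn.
by case: (odd d); rewrite ?leq_add2r // leq_addl.
Qed.

Let reta : r%:R ^+ 2 * ((k * m)%:R * m%:R / n%:R) ^+ d./2.+1 <= sigma ^+ 2 / 80.
Proof.
apply: (@le_trans _ _ ((C * w) `^ (d%:R / 2) * (eps / Del) ^+ 3
    * (48 / w) `^ (d%:R / 2))).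
  apply: ler_pM => //; first by rewrite exprn_ge0 // ler0n.
  by rewrite exprn_ge0 // divr_ge0 ?mulr_ge0 ?ler0n.
rewrite mulrAC -powRM; last 2 first.
- by rewrite ltW // mulr_gt0.
- by rewrite ltW // divr_gt0.
have -> : C * w * (48 / w) = c0 ^+ 2 by rewrite -CE; field; rewrite gt_eqF.
have -> : (c0 ^+ 2) `^ (d%:R / 2) = c0 ^+ d.
  rewrite -powR_mulrn ?(ltW c0_gt0) // -powRrM mulrCA divff ?pnatr_eq0 // mulr1.
  by rewrite powR_mulrn // ltW.
have cd : c0 ^+ d <= 11520^-1.
  apply: le_trans c0_le; rewrite -[leRHS]expr1 ler_wiXn2l // ?(ltW c0_gt0) //.
  by apply: le_trans c0_le _; rewrite invf_le1 ?ler1n ?ltr0n.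
rewrite sigmaE; move: ratio0 ratio1; set q := eps / Del => q0 q1.
(* 11520 is 80 * 12^2. *)
have -> : (q / 12) ^+ 2 / 80 = 11520^-1 * q ^+ 2 by field.
apply: ler_pM => //; rewrite ?exprn_ge0 ?(ltW c0_gt0) ?(ltW q0) //.
by rewrite exprS ler_piMl // exprn_ge0 // ltW.
Qed.

Lemma exists_parameters : exists (l : nat) (s tau delta : R),
  [/\ (0 < l)%N, 0 < s, 0 < tau,
    delta = tau + (1 + tau^-1) *
      (4 * r%:R ^+ 2 * ((l * m)%:R * m%:R / n%:R) ^+ d./2.+1)
    & 3 * (Del * s + Del * (1 + s) / l.*2%:R * r%:R
        * ((1 + delta) / (1 + s)) ^+ l.*2) <= eps].
Proof.
(* Both terms of [delta] are then at most [sigma / 4], the second one by [reta]. *)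
pose tau := sigma / 4.
have tau0 : 0 < tau by rewrite divr_gt0.
pose delta := tau + (1 + tau^-1) *
      (4 * r%:R ^+ 2 * ((k * m)%:R * m%:R / n%:R) ^+ d./2.+1).
exists k, sigma, tau, delta; split=> //.
have Y0 : 0 <= r%:R ^+ 2 * ((k * m)%:R * m%:R / n%:R) ^+ d./2.+1 :> R.
  by rewrite mulr_ge0 ?exprn_ge0 ?divr_ge0 ?mulr_ge0 ?ler0n.
have delta_le : delta <= sigma / 2.
  rewrite /delta -[4 * _ * _]mulrA.
  move: Y0 reta; set Y := r%:R ^+ 2 * _ => Y0 Yle.
  have tauV : 1 + tau^-1 <= 5 / sigma.
    rewrite /tau invf_div ler_pdivlMr // mulrDl mul1r divfK ?gt_eqF //.
    by have := sigma1; lra.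
  have : (1 + tau^-1) * (4 * Y) <= 5 / sigma * (4 * (sigma ^+ 2 / 80)).
    apply: ler_pM => //.
    - by rewrite addr_ge0 // invr_ge0 ltW.
    - by rewrite mulr_ge0.
    - by rewrite ler_pM2l.
  have -> : 5 / sigma * (4 * (sigma ^+ 2 / 80)) = sigma / 4.
    by field; rewrite gt_eqF.
  by move: ((1 + tau^-1) * _) => Z; rewrite /tau; lra.
have delta0 : 0 <= delta.
  rewrite /delta -[4 * _ * _]mulrA.
  apply: addr_ge0; first exact: ltW.
  by apply: mulr_ge0; [rewrite addr_ge0 // invr_ge0 ltW|apply: mulr_ge0].
pose q := (1 + delta) / (1 + sigma).
have s10 : 0 < 1 + sigma by rewrite addr_gt0.
have q0 : 0 <= q by apply: divr_ge0; [rewrite addr_ge0|exact: ltW].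
(* As [sigma <= 1], [1 + sigma / 2] is at most [(1 - sigma / 4) (1 + sigma)]. *)
have qle : q <= sequences.expR (- (sigma / 4)).
  apply: le_trans (expR_ge1Dx _); rewrite ler_pdivrMr //.
  have s2 : sigma ^+ 2 <= sigma by rewrite expr2 ler_piMl ?(ltW sigma0).
  have -> : (1 + - (sigma / 4)) * (1 + sigma) = 1 + 3 * sigma / 4 - sigma ^+ 2 / 4.
    by field.
  by have := delta_le; lra.
(* The decay over [k.*2] steps is at most [n^(-d)], which beats [r <= n^d]. *)
have rp : r%:R * q ^+ k.*2 <= 1.
  have nd0 : 0 < n%:R ^+ d :> R by rewrite exprn_gt0.
  apply: (@le_trans _ _ (n%:R ^+ d * (n%:R ^+ d)^-1)); last by rewrite mulfV ?gt_eqF.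
  apply: ler_pM => //; first by rewrite exprn_ge0.
  apply: (@le_trans _ _ (sequences.expR (- (sigma / 4)) ^+ k.*2)).
    by rewrite lerXn2r // nnegrE ltW // expR_gt0.
  rewrite -expRM_natl.
  have -> : (n%:R ^+ d)^-1 = sequences.expR (- (d%:R * ln n%:R)) :> R.
    by rewrite expRN expRM_natl lnK // posrE.
  rewrite ler_expR mulrN lerN2 -muln2 natrM.
  have -> : d%:R * ln n%:R = X * sigma / 2 :> R.
    by rewrite /X; field; rewrite gt_eqF.
  have : X * sigma <= k%:R * sigma by rewrite ler_pM2r // ltW.
  by lra.
rewrite -/q.
have Ds : Del * sigma = eps / 12 by rewrite /sigma; field; rewrite gt_eqF.
have Dk : Del / k%:R <= eps / 12.
  rewrite -Ds ler_pM2l // -[leRHS]invrK lef_pV2 ?posrE ?invr_gt0 //.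
  exact: le_trans X1 (ltW kX).
have t1 : Del * (1 + sigma) / k.*2%:R <= Del / k%:R.
  have -> : Del * (1 + sigma) / k.*2%:R = Del / k%:R * ((1 + sigma) / 2).
    by rewrite -muln2 natrM; field; rewrite gt_eqF.
  rewrite ler_piMr ?divr_ge0 ?ler0n ?(ltW DP) //.
  by rewrite ler_pdivrMr // mul1r -[leRHS]/(1 + 1) lerD2l.
have t2 : Del * (1 + sigma) / k.*2%:R * r%:R * q ^+ k.*2 <= Del * (1 + sigma) / k.*2%:R.
  rewrite -mulrA ler_piMr //; apply: divr_ge0; last exact: ler0n.
  by rewrite ltW // mulr_gt0.
apply: (@le_trans _ _ (3 * (eps / 12 + eps / 12))).
  by rewrite ler_pM2l // Ds lerD2l; exact: le_trans t2 (le_trans t1 Dk).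
have -> : 3 * (eps / 12 + eps / 12) = eps / 2 by field.
by rewrite ler_pdivrMr // ler_peMr ?ler1n // ltW.
Qed.

End ParameterChoice.

(** * Assembly of the bound *)

Lemma LD_bound_parameters (R : realType) (m d : nat) (C c0 eps : R)
    (D : cube m -> R) :
  0 < C -> 0 < c0 -> c0 <= 11520^-1 -> 48 * C = c0 ^+ 2 ->
  (1 <= m)%N -> (1 <= d)%N -> 0 < eps <= 1 -> pseudo_density d D ->
  LD_bound_with d eps D
    ((C * eps / (d%:R * m%:R ^+ 2 * max_norm D)) `^ (d%:R / 2)
     * (eps / max_norm D) ^+ 3).
Proof.
move=> C0 c0_gt0 c0_le CE m0 d0 /andP[eps0 eps1] Dpd n N mn N0 Nmax hyp.
have mn' : (m <= n)%N by apply: leq_trans mn; rewrite leq_pmull.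
have n2 : (2 <= n)%N by apply: leq_trans mn; rewrite leq_pmulr.
have n0 : (0 < n)%N by exact: ltnW.
have N1 S x : N S x <= 1.
  apply: le_trans Nmax.
  exact: (le_bigmax _ (fun e : msubsets n m * cube n => N e.1 e.2) (S, x)).
have N_eq0 : (forall S x, N S x = 0) -> - eps <= LD D N.
  move=> Nz; have -> : LD D N = 0; last by rewrite oppr_le0 ltW.
  rewrite /LD /mean big1 ?mul0r // => x _.
  by rewrite big1 ?mul0r // => S _; rewrite Nz mulr0.
have [S0 _] : exists S0 : msubsets n m, true.
  have : (0 < #|{: msubsets n m}|)%N by rewrite card_msubsets bin_gt0.
  by case/card_gt0P => S _; exists S.
have mu0 : 0 <= mx_mean N by apply: mean_ge0.
(* Division by a zero mean yields 0, so this case is settled directly: nonnegative entries of mean 0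
   all vanish. *)
have [mu_eq0|mu_neq0] := eqVneq (mx_mean N) 0.
  apply: N_eq0 => S x; apply/eqP; move/eqP: mu_eq0.
  rewrite /mx_mean /mean mulf_eq0 invr_eq0 pnatr_eq0 => /orP[|]; last first.
    by move/eqP/card0_eq/(_ (S, x)); rewrite inE.
  rewrite psumr_eq0 => [/allP/(_ (S, x))|//].
  by rewrite mem_index_enum => /(_ isT).
have {}mu0 : 0 < mx_mean N by rewrite lt_neqAle eq_sym mu_neq0.
have mu1 : mx_mean N <= 1.
  by rewrite -(mean_const (S0, cube0 n) 1); apply: ler_mean.
have [[A [B [Apsd Bpsd NE]]] _] := psd_rankP N0.
(* Rank 0 makes every entry an empty trace. Otherwise the size is a successor, which gives the
   matrices their ring structure. *)
move: A B Apsd Bpsd NE hyp; case: (psd_rank N) => [|r] A B Apsd Bpsd NE hyp.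
  by apply: N_eq0 => S x; rewrite NE /mxtrace big_ord0.
have Del1 := max_norm_density_ge1 Dpd.
have hr : r.+1%:R ^+ 2 <=
    (C * eps / (d%:R * m%:R ^+ 2 * max_norm D)) `^ (d%:R / 2)
    * (eps / max_norm D) ^+ 3 * (n%:R / ln n%:R) `^ (d%:R / 2).
  (* The mean of [N] is at most 1, so dividing by it only increases the left side. *)
  apply: le_trans hyp; rewrite ler_peMl ?exprn_ge0 ?ler0n //.
  by rewrite ler_pdivlMr // mul1r.
have [k [s [tau [delta [k0 s0 tau0 dE le_eps]]]]] :=
  exists_parameters n2 m0 d0 (ltn0Sn r) C0 c0_gt0 c0_le CE eps0 eps1 Del1 hr.
have AB1 S x : \tr (A S *m B x) <= 1 by rewrite -NE.
have [P [Q [[Ppsd Qpsd] PQ Pmean Plam Qtr]]] :=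
  psd_normalize S0 (ltn0Sn r) Apsd Bpsd AB1.
have -> : LD D N = LD D (fun S x => \tr (P S *m Q x)).
  by apply: eq_mean => x; apply: eq_mean => S; rewrite NE PQ.
have lam0 : 0 <= 4 * r.+1%:R ^+ 2 :> R by rewrite mulr_ge0 ?exprn_ge0 ?ler0n.
apply: le_trans (LD_lower lam0 mn' n0 Dpd Ppsd Qpsd Pmean Plam Qtr k0 s0 tau0 dE).
by rewrite lerN2.
Qed.

Theorem theorem3p1 (R : realType) :
  (forall (m d : nat) (eps : R) (D : cube m -> R),
     (1 <= m)%N -> (1 <= d)%N -> 0 < eps <= 1 -> pseudo_density d D ->
     exists2 alpha : R, 0 < alpha & LD_bound_with d eps D alpha) /\
  (exists2 C : R, 0 < C &
     forall (m d : nat) (eps : R) (D : cube m -> R),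
       (1 <= m)%N -> (1 <= d)%N -> 0 < eps <= 1 -> pseudo_density d D ->
       LD_bound_with d eps D
         ((C * eps / (d%:R * m%:R ^+ 2 * max_norm D)) `^ (d%:R / 2)
          * (eps / max_norm D) ^+ 3)).
Proof.
(* [c0] is the largest value allowed by [c0_le], and [C] solves [48 * C = c0 ^+ 2]. *)
pose c0 : R := 11520^-1; pose C : R := 48^-1 * c0 ^+ 2.
have c0_gt0 : 0 < c0 by rewrite invr_gt0 ltr0n.
have C0 : 0 < C by rewrite mulr_gt0 ?exprn_gt0 ?invr_gt0 ?ltr0n.
have CE : 48 * C = c0 ^+ 2 by rewrite mulrA divff ?mul1r // pnatr_eq0.
have bound m d eps D := @LD_bound_parameters R m d C c0 eps D C0 c0_gt0 (lexx _) CE.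
split; last by exists C.
move=> m d eps D m0 d0 eps01 Dpd.
exists ((C * eps / (d%:R * m%:R ^+ 2 * max_norm D)) `^ (d%:R / 2)
          * (eps / max_norm D) ^+ 3); last exact: bound.
have /andP[eps0 _] := eps01.
have Del0 : 0 < max_norm D := lt_le_trans ltr01 (max_norm_density_ge1 Dpd).
apply: mulr_gt0; last by rewrite exprn_gt0 // divr_gt0.
apply/powR_gt0/divr_gt0; first exact: mulr_gt0.
by rewrite !mulr_gt0 ?exprn_gt0 ?ltr0n.
Qed.
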